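(* Let $N=\binom n2$, let $0<p<1$ be a real and $0<m<N$ and $h$ integers (all depending on $n$) satisfying $m=pN$, $h^2=\Omega(m)$, $h^3=o(m^2)$ (or equivalently $h^3=o(p^2n^4)$) and $h^{8/3}=o(pn^3)$. Assume $\Delta=\Delta(n)=\Theta(h^{1/3})$ is an integer. Let $\mathscr S$ be the set of all triangle-free graphs on the vertex set $[n]$ with $h$ edges and maximum degree at most $\Delta$, and let $X_n$ denote the number of triangle-free subgraphs with $h$ edges and maximum degree at most $\Delta$, i.e. the number of members of $\mathscr S$ contained in the random graph ($\mathcal G(n,m)$ or $\mathcal G(n,p)$). Let $\mu_n=|\mathscr S|\binom{N-h}{m-h}\big/\binom Nm$, $\lambda_n=|\mathscr S|p^h$ and $\beta_n=h\sqrt{(1-p)/(pN)}$. Then $X_n/\mu_n\xrightarrow{p}1$ in $\mathcal G(n,m)$, and $$\frac{\ln\bigl(e^{\beta_n^2/2}X_n/\lambda_n\bigr)}{\beta_n}\xrightarrow{d}\mathcal N(0,1)\quad\text{in }\mathcal G(n,p),$$ provided $\liminf_{n\to\infty}\beta_n>0$.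
   Context: $\mathcal G(n,m)$ is the uniformly random graph on vertex set $[n]$ with exactly $m$ edges; $\mathcal G(n,p)$ is the binomial random graph on $[n]$ with edge probability $p$. All asymptotics are as $n\to\infty$. Subgraphs are counted as spanning subgraphs (i.e. as edge sets on $[n]$). The proviso $\liminf\beta_n>0$ applies to the convergence in distribution. $\mathcal N(0,1)$ is the standard normal distribution; $\xrightarrow{p}$, $\xrightarrow{d}$ denote convergence in probability and in distribution. *)

(* Defs.v *)
From HB Require Import structures.
From mathcomp Require Import all_boot all_order all_algebra.
From mathcomp Require Import all_classical all_reals all_analysis.

Set Implicit Arguments.
Unset Strict Implicit.
Unset Printing Implicit Defensive.

Import Order.TTheory GRing.Theory Num.Theory.
Import numFieldNormedType.Exports.

Local Open Scope ring_scope.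

(* A graph on the vertex set 'I_n is its edge set, so containment of spanning
   subgraphs is \subset and the number of edges is the cardinal. *)
Definition edge (n : nat) := {e : {set 'I_n} | #|e| == 2}.
Definition graph (n : nat) := {set edge n}.

(* Irreflexive, since [set x; x] has one element. *)
Definition adj n (G : graph n) (x y : 'I_n) : bool :=
  [exists e in G, val e == [set x; y]%SET].

Definition degree n (G : graph n) (x : 'I_n) : nat := #|[pred y | adj G x y]|.

Definition triangle_free n (G : graph n) : bool :=
  [forall x, forall y, forall z, ~~ [&& adj G x y, adj G y z & adj G x z]].

Definition tf_family n (h D : nat) : {set graph n} :=
  [set H : graph n | [&& triangle_free H, #|H| == h
                       & [forall x, degree H x <= D]%N]]%SET.

Definition tf_count n (h D : nat) (G : graph n) : nat :=
  #|[set H in tf_family n h D | H \subset G]%SET|.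

Definition gnm (R : realType) n (m : nat) (A : pred (graph n)) : R :=
  #|[pred G : graph n | (#|G| == m) && A G]|%:R
    / #|[pred G : graph n | #|G| == m]|%:R.

Definition gnp (R : realType) n (p : R) (A : pred (graph n)) : R :=
  \sum_(G : graph n | A G) p ^+ #|G| * (1 - p) ^+ ('C(n, 2) - #|G|).

Local Open Scope classical_set_scope.

Definition cvg_in_probability (R : realType) (T : nat -> Type)
    (P : forall n, pred (T n) -> R) (Y : forall n, T n -> R) (c : R) : Prop :=
  forall e : R, 0 < e ->
    P n [pred w | e < `|Y n w - c|] @[n --> \oo] --> (0 : R).

(* Pointwise convergence of distribution functions at the continuity points of
   the limit.  The variables may take the value -oo, which is lne 0. *)
Definition cvg_in_distribution (R : realType) (T : nat -> Type)
    (P : forall n, pred (T n) -> R) (Y : forall n, T n -> \bar R)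
    (mu : probability (measurableTypeR R) R) : Prop :=
  let F (x : R) : R := fine (mu `]-oo, x]) in
  forall x : R, {for x, continuous F} ->
    P n [pred w | (Y n w <= x%:E)%E] @[n --> \oo] --> F x.

(* Natural subtraction is harmless here: h ^ 3 = o(m ^ 2) with m > 0 forces
   h <= m for all large n. *)
Definition mu_ (R : realType) (m h D n : nat) : R :=
  #|tf_family n h D|%:R * 'C('C(n, 2) - h, m - h)%:R / 'C('C(n, 2), m)%:R.

Definition lambda_ (R : realType) (p : R) (h D n : nat) : R :=
  #|tf_family n h D|%:R * p ^+ h.

Definition beta_ (R : realType) (p : R) (h n : nat) : R :=
  h%:R * Num.sqrt ((1 - p) / (p * 'C(n, 2)%:R)).

(* Main.v *)
From HB Require Import structures.
Require Import Defs.
From mathcomp Require Import all_boot all_order all_algebra.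
From mathcomp Require Import all_classical all_reals all_analysis.
From mathcomp Require Import measurable_realfun.
From mathcomp Require Import ring lra zify.

(**
   Write N for the number of pairs of vertices and S for the family of
   triangle-free graphs with h edges and maximum degree at most Delta.

   Concentration in G(n,m).  By Chebyshev's inequality it is enough that
   E X^2 / (E X)^2 tends to 1.  For an arbitrary family of h-subsets of an
   N-set, E X^2 is governed by the sizes of the overlaps of two members of the
   family.  If the family consisted of all h-subsets, the overlap sizes would be
   hypergeometric and the ratio would be exactly 1, because X is then constant.
   Triangle-freeness makes the true overlap distribution very different from the
   hypergeometric one, but only the ratios of consecutive probabilities matter.
   Deleting a common edge from the second member and inserting an edge outside
   both (overlap_switch) shows that the probability of overlap j + 1 divided by
   that of overlap j is at most N / K times the hypergeometric ratio, where K is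
   the least number of admissible insertions.  So the true distribution,
   divided by the hypergeometric one tilted by (N / K)^j, is nonincreasing in j,
   while the probability that G(n,m) contains two given members with overlap j is
   nondecreasing in j; the two are negatively correlated (correlation_sum), and
   what is left to bound is the generating function at N / K of an overlap of two
   h-subsets of an m-set (overlap_pgf_le).  The result is
   E X^2 / (E X)^2 <= (1 + (N / K - 1) h / m)^h (sum_count_in_sqr_le).

   An insertion is inadmissible only if the edge is already present, closes a
   path of two edges, or meets a vertex of full degree, which excludes
   O(h + h Delta + h n / Delta) edges (card_blocked).  For Delta of order
   h^(1/3) this is O(h^(2/3) n), and the bound above becomes
   exp(O(h^(8/3) / (p n^3))), which tends to 1.

   Fluctuations in G(n,p).  Given that G(n,p) has k edges it is G(n,k), so X is
   close to its mean mu(k), and mu(k) / lambda is the product of the factors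
   (k - i) / (m - p i), i < h.  Expanding its logarithm for k = m + z s, where
   s^2 = m (1 - p) is the variance of the number of edges, gives
   beta z - beta^2 / 2 up to an error that is small compared with beta
   (mean_ratio_error).  Hence the normalized logarithm is close to z
   (ln_normalized_count), and the theorem follows from the central limit theorem
   for the binomial distribution with variance tending to infinity
   (binomial_clt).  The condition liminf beta > 0 makes s tend to infinity.

   The central limit theorem is proved by comparing ratios: near the mean m, the
   quotient of two binomial probabilities is asymptotically the quotient of
   the Gaussian masses of the corresponding cells of length 1/s.
   Multiplied out, this compares the products of a binomial mass and a Gaussian
   mass of two sets; as both distributions have total mass 1 and small
   tails, the masses themselves are close (mass_comparison).
*)

Set Implicit Arguments.
Unset Strict Implicit.
Unset Printing Implicit Defensive.

Import Order.TTheory GRing.Theory Num.Theory.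
Import numFieldNormedType.Exports.

Local Open Scope ring_scope.

(** * Overlaps of the members of a set family *)

(** Chebyshev's sum inequality for weights: F / a is nonincreasing and w is
    nondecreasing, so they are negatively correlated under the weight a.  The
    cross-multiplied form of the hypothesis avoids division by a. *)
Lemma correlation_sum (R : realFieldType) (n : nat) (F a w : 'I_n -> R) :
  (forall i j : 'I_n, (i <= j)%N -> F j * a i <= F i * a j) ->
  (forall i j : 'I_n, (i <= j)%N -> w i <= w j) ->
  (\sum_i F i * w i) * (\sum_i a i) <= (\sum_i F i) * (\sum_i a i * w i).
Proof.
move=> Fa ww; rewrite -subr_ge0.
set D := _ - _.
have DE : D = \sum_i \sum_j w j * (F i * a j - F j * a i).
  rewrite /D !big_distrlr/= [X in _ - X]exchange_big/= -sumrB.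
  by apply: eq_bigr => i _; rewrite -sumrB; apply: eq_bigr => j _; ring.
have DE' : D = \sum_i \sum_j - w i * (F i * a j - F j * a i).
  rewrite DE exchange_big/=.
  by apply: eq_bigr => i _; apply: eq_bigr => j _; ring.
(* Exchanging the two indices negates the bracket, so 2 D is a sum of
   products of two factors of equal sign. *)
suff : 0 <= D + D by lra.
rewrite {1}DE DE' -big_split/= sumr_ge0// => i _.
rewrite -big_split/= sumr_ge0// => j _.
have -> : w j * (F i * a j - F j * a i) + - w i * (F i * a j - F j * a i)
  = (w j - w i) * (F i * a j - F j * a i) by ring.
have [ij|/ltnW ji] := leqP i j.
  by rewrite mulr_ge0// subr_ge0 ?ww ?Fa.
by rewrite mulr_le0// subr_le0 ?ww ?Fa.
Qed.

(** The quotient of the two binomials is the probability that i given points of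
    an m-set lie in a random h-subset; it is a product of i factors
    (h - l) / (m - l), none larger than h / m. *)
Lemma leq_bin_sub (R : realFieldType) (m h i : nat) : (h <= m)%N -> (0 < m)%N ->
  (i <= h)%N ->
  'C(m - i, h - i)%:R <= 'C(m, h)%:R * (h%:R / m%:R) ^+ i :> R.
Proof.
move=> hm m0; elim: i => [|i IH] ih; first by rewrite !subn0 expr0 mulr1.
have mi : (0 < m - i)%N by rewrite subn_gt0; lia.
have E : ((m - i) * 'C(m - i.+1, h - i.+1) = (h - i) * 'C(m - i, h - i))%N.
  have -> : (m - i = (m - i.+1).+1)%N by lia.
  have -> : (h - i = (h - i.+1).+1)%N by lia.
  by rewrite -mul_bin_diag.
have -> : 'C(m - i.+1, h - i.+1)%:R
    = (h - i)%:R / (m - i)%:R * 'C(m - i, h - i)%:R :> R.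
  apply: (mulfI (_ : (m - i)%:R != 0)); first by rewrite pnatr_eq0; lia.
  by rewrite -natrM E natrM mulrA mulrCA divff ?mulr1// pnatr_eq0; lia.
have le1 : (h - i)%:R / (m - i)%:R <= h%:R / m%:R :> R.
  rewrite ler_pdivrMr ?ltr0n// mulrAC ler_pdivlMr ?ltr0n// -!natrM ler_nat.
  nia.
rewrite exprSr mulrA mulrC.
by apply: ler_pM => //; rewrite ?divr_ge0// IH// ltnW.
Qed.

Lemma bin_chain h i l : (l + i <= h)%N ->
  ('C(l + i, i) * 'C(h, l + i) = 'C(h, i) * 'C(h - i, l))%N.
Proof.
move=> lh.
apply/eqP; rewrite -(eqn_pmul2r (_ : 0 < i`! * l`! * (h - i - l)`!))%N; last first.
  by rewrite !muln_gt0 !fact_gt0.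
have E1 : ('C(l + i, i) * (i`! * l`!) = (l + i)`!)%N.
  by have := @bin_fact (l + i) i (leq_addl _ _); rewrite addnK.
have E2 : ('C(h, l + i) * ((l + i)`! * (h - i - l)`!) = h`!)%N.
  by rewrite (_ : h - i - l = h - (l + i))%N ?bin_fact//; lia.
have E3 : ('C(h, i) * (i`! * (h - i)`!) = h`!)%N by rewrite bin_fact//; lia.
have E4 : ('C(h - i, l) * (l`! * (h - i - l)`!) = (h - i)`!)%N.
  by rewrite bin_fact//; lia.
apply/eqP; transitivity h`!; last by rewrite -E3 -E4; ring.
by rewrite -E2 -E1; ring.
Qed.

(** Up to the factor 'C(m, h), the left-hand side is the generating function
    E (1 + d)^J of the overlap J of two h-subsets of an m-set.  Its i-th binomial
    moment is at most that of the binomial distribution with h trials of success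
    probability h / m, whose generating function is the bound. *)
Lemma overlap_pgf_le (R : realFieldType) (m h : nat) (d : R) :
  (h <= m)%N -> (0 < m)%N -> 0 <= d ->
  \sum_(j < h.+1) (1 + d) ^+ j * ('C(h, j) * 'C(m - h, h - j))%:R
    <= 'C(m, h)%:R * (1 + d * h%:R / m%:R) ^+ h.
Proof.
move=> hm m0 d0.
have -> : \sum_(j < h.+1) (1 + d) ^+ j * ('C(h, j) * 'C(m - h, h - j))%:R
    = \sum_(i < h.+1) d ^+ i * ('C(h, i) * 'C(m - i, h - i))%:R.
  (* Expand (1 + d)^j, exchange the sums and apply Vandermonde's identity. *)
  transitivity (\sum_(j < h.+1) \sum_(i < h.+1)
     d ^+ i * ('C(j, i) * ('C(h, j) * 'C(m - h, h - j)))%:R).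
    apply: eq_bigr => j _; rewrite exprDn mulr_suml.
    rewrite (big_ord_widen_cond h.+1 xpredT
      (fun i => 1 ^+ (j - i) * d ^+ i *+ 'C(j, i) *
                ('C(h, j) * 'C(m - h, h - j))%:R))//.
    rewrite big_mkcond; apply: eq_bigr => i _ /=; case: ifPn => ij.
      by rewrite expr1n mul1r -mulr_natr -mulrA -natrM.
    by rewrite (@bin_small j i) ?mul0n ?mulr0//; lia.
  rewrite exchange_big/=; apply: eq_bigr => i _.
  have ih := ltn_ord i.
  rewrite -mulr_sumr -natr_sum; congr (_ * _%:R).
  rewrite (_ : 'C(m - i, h - i) = 'C((h - i) + (m - h), h - i)); last first.
    by congr binomial; lia.
  rewrite -binomial.Vandermonde big_distrr/=.
  rewrite -(big_mkord xpredT (fun j => 'C(j, i) * ('C(h, j) * 'C(m - h, h - j)))%N).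
  rewrite (@big_cat_nat _ _ _ i)//=; last by lia.
  rewrite big1_seq ?add0n; last first.
    by move=> j; rewrite mem_index_iota => /andP[_ /andP[_ ji]]; rewrite bin_small.
  rewrite -{1}(add0n (i : nat)) big_addn big_mkord.
  rewrite (_ : h.+1 - i = (h - i).+1)%N; last by lia.
  apply: eq_bigr => l _; rewrite !mulnA; congr (_ * 'C(_, _))%N; last by lia.
  have lh := ltn_ord l.
  by rewrite bin_chain//; lia.
rewrite exprDn mulr_sumr; apply: ler_sum => i _.
have ih : (i <= h)%N by have := ltn_ord i.
have -> : 'C(m, h)%:R * (1 ^+ (h - i) * (d * h%:R / m%:R) ^+ i *+ 'C(h, i))
    = d ^+ i * 'C(h, i)%:R * ('C(m, h)%:R * (h%:R / m%:R) ^+ i) :> R.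
  by rewrite expr1n -mulr_natr -mulrA !exprMn; ring.
by rewrite natrM mulrA ler_wpM2l ?leq_bin_sub// mulr_ge0 ?exprn_ge0.
Qed.

(** Insertions into A are excluded so that each exchange lowers the overlap
    with A. *)
Definition swaps (T : finType) (S : {set {set T}}) (A B : {set T}) (x : T) :
    {set T} :=
  [set y | [&& y \notin A, y \notin B & y |: (B :\ x) \in S]].

Definition overlap_count (T : finType) (S : {set {set T}}) (A : {set T})
    (j : nat) : nat :=
  #|[set B in S | #|A :&: B| == j]|.

(** Double counting of the exchanges that lower the overlap with A by one.  From
    each B with overlap j + 1 there are at least (j + 1) K of them, while an
    exchange that produces a given B' is determined by the element of A that was
    removed and the element outside A that was inserted, which leaves (h - j)^2
    possibilities. *)
Lemma overlap_switch (R : realFieldType) (T : finType) (S : {set {set T}})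
    (h : nat) (K : R) (A : {set T}) (j : nat) :
  (forall B, B \in S -> #|B| = h) -> A \in S ->
  (forall B x, B \in S -> x \in A -> x \in B -> K <= #|swaps S A B x|%:R) ->
  (overlap_count S A j.+1)%:R * (j.+1%:R * K)
    <= (overlap_count S A j)%:R * (h - j)%:R ^+ 2.
Proof.
move=> Sh AS HK.
set F1 := [set B in S | #|A :&: B| == j.+1].
set F0 := [set B in S | #|A :&: B| == j].
pose P := [set t : {set T} * (T * T) | [&& t.1 \in F1, t.2.1 \in A :&: t.1 &
            t.2.2 \in swaps S A t.1 t.2.1]].
pose Q := [set t : {set T} * (T * T) | [&& t.1 \in F0, t.2.1 \in A :\: t.1 &
            t.2.2 \in t.1 :\: A]].
have cP : (overlap_count S A j.+1)%:R * (j.+1%:R * K) <= #|P|%:R.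
  rewrite -sum1_card (eq_bigl (fun t : {set T} * (T * T) => (t.1 \in F1) &&
    ((t.2.1 \in A :&: t.1) && (t.2.2 \in swaps S A t.1 t.2.1)))); last first.
    by move=> t; rewrite inE.
  rewrite -(pair_big_dep (mem F1) (fun B xy => (xy.1 \in A :&: B) &&
    (xy.2 \in swaps S A B xy.1)) (fun _ _ => 1%N))/= natr_sum.
  rewrite /overlap_count -/F1 -sum1_card natr_sum mulr_suml.
  apply: ler_sum => B; rewrite inE => /andP[BS /eqP Bj]; rewrite mul1r.
  rewrite -(pair_big_dep (mem (A :&: B)) (fun x y => y \in swaps S A B x)
    (fun _ _ => 1%N))/= natr_sum.
  rewrite -Bj -sum1_card natr_sum mulr_suml; apply: ler_sum => x.
  by rewrite inE => /andP[xA xB]; rewrite mul1r sum1_card; exact: HK.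
have cQ : (#|Q| <= overlap_count S A j * (h - j) ^ 2)%N.
  rewrite -sum1_card (eq_bigl (fun t : {set T} * (T * T) => (t.1 \in F0) &&
    ((t.2.1 \in A :\: t.1) && (t.2.2 \in t.1 :\: A)))); last first.
    by move=> t; rewrite inE.
  rewrite -(pair_big_dep (mem F0) (fun B xy => (xy.1 \in A :\: B) &&
    (xy.2 \in B :\: A)) (fun _ _ => 1%N))/=.
  rewrite /overlap_count -/F0 -sum1_card big_distrl/=.
  apply: leq_sum => B; rewrite inE => /andP[BS /eqP Bj]; rewrite mul1n.
  rewrite -(pair_big (mem (A :\: B)) (mem (B :\: A)) (fun _ _ => 1%N))/=.
  rewrite sum_nat_const sum1_card !cardsD (finset.setIC B) Bj (Sh _ AS) (Sh _ BS).
  by rewrite mulnn.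
apply: (le_trans cP); rewrite -natrX -natrM ler_nat; apply: leq_trans cQ.
(* The exchange itself; keeping the two elements makes it injective. *)
pose f (t : {set T} * (T * T)) := (t.2.2 |: (t.1 :\ t.2.1), t.2).
rewrite -(card_in_imset (f := f)).
  apply/subset_leq_card/fintype.subsetP => _ /imsetP[[B [x y]] + ->].
  rewrite !inE/= => /and3P[/andP[BS /eqP Bj] /andP[xA xB]].
  move=> /and3P[yA yB ->]/=; rewrite xA yA eqxx/= !andbT.
  have xy : x != y by apply: contraNneq yA => <-.
  rewrite eqxx (negbTE xy)/= !andbT -eqSS -Bj (cardsD1 x (A :&: B)) !inE xA xB add1n eqSS.
  apply/eqP; congr #|pred_of_set _|; apply/finset.setP => z; rewrite !inE.
  have [->|_] /= := eqVneq z y; first by rewrite (negbTE yA) andbF.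
  by case: (z \in A); rewrite /= ?andbF ?andbT.
move=> [B [x y]] [B' [x' y']]; rewrite !inE/=.
move=> /and3P[_ /andP[xA xB] /and3P[yA yB _]].
move=> /and3P[_ /andP[xA' xB'] /and3P[yA' yB' _]] [+ ex ey].
rewrite -{}ex -{}ey in xA' xB' yA' yB' * => E; congr (_, _).
apply/finset.setP => z; move/finset.setP: E => /(_ z); rewrite !inE.
have [->|_] := eqVneq z x; first by rewrite xB xB'.
by have [->|//] := eqVneq z y; rewrite (negbTE yB) (negbTE yB').
Qed.

(** Counting complements keeps the formula valid, with value 0, when A has more
    than m elements. *)
Lemma card_supersets (T : finType) (A : {set T}) (m : nat) : (m <= #|T|)%N ->
  #|[set G : {set T} | (#|G| == m) && (A \subset G)]|
    = 'C(#|T| - #|A|, #|T| - m).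
Proof.
move=> mT; rewrite -(card_imset _ (can_inj (@finset.setCK T))).
rewrite -(cardsC A) addKn -(cards_draws (~: A)) cardsC.
apply: eq_card => B; rewrite !inE; apply/imsetP/andP => [[G]|[BA /eqP Bc]].
  rewrite inE => /andP[/eqP Gm AG] ->; rewrite finset.setCS; split => //.
  by rewrite -(cardsC G) Gm addKn.
exists (~: B); last by rewrite finset.setCK.
rewrite inE -finset.setCS finset.setCK BA andbT.
by have := cardsC B; rewrite Bc; lia.
Qed.

Definition count_in (T : finType) (S : {set {set T}}) (G : {set T}) : nat :=
  #|[set H in S | H \subset G]|.

Lemma count_in_sum (T : finType) (S : {set {set T}}) (G : {set T}) :
  count_in S G = (\sum_(H in S) (H \subset G))%N.
Proof.
rewrite /count_in -sum1_card big_mkcond [RHS]big_mkcond; apply: eq_bigr => H _.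
by rewrite inE; case: (H \in S); case: (H \subset G).
Qed.

Lemma sum_count_in (T : finType) (S : {set {set T}}) (h m : nat) :
  (m <= #|T|)%N -> (forall B, B \in S -> #|B| = h) ->
  (\sum_(G : {set T} | #|G| == m) count_in S G
    = #|S| * 'C(#|T| - h, #|T| - m))%N.
Proof.
move=> mT Sh; transitivity (\sum_(G : {set T} | #|G| == m)
    \sum_(H in S) (H \subset G) : nat)%N.
  by apply: eq_bigr => G _; rewrite count_in_sum.
rewrite exchange_big/= -sum_nat_const; apply: eq_bigr => H HS.
rewrite -(Sh H HS) -card_supersets// -sum1_card big_mkcond [RHS]big_mkcond/=.
by apply: eq_bigr => G _; rewrite inE; case: eqP; case: (H \subset G).
Qed.

(** Two members of S with overlap j are both contained in G exactly if their
    union, of size 2 h - j, is. *)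
Lemma sum_count_in_sqr (T : finType) (S : {set {set T}}) (h m : nat) :
  (m <= #|T|)%N -> (forall B, B \in S -> #|B| = h) ->
  (\sum_(G : {set T} | #|G| == m) count_in S G ^ 2 =
   \sum_(A in S) \sum_(j < h.+1)
     overlap_count S A j * 'C(#|T| - (2 * h - j), #|T| - m))%N.
Proof.
move=> mT Sh; transitivity (\sum_(G : {set T} | #|G| == m)
    \sum_(A in S) \sum_(B in S) ((A :|: B) \subset G) : nat)%N.
  apply: eq_bigr => G _; rewrite count_in_sum -mulnn big_distrlr/=.
  apply: eq_bigr => A _; apply: eq_bigr => B _.
  by rewrite finset.subUset; case: (A \subset G); case: (B \subset G).
rewrite exchange_big/=; apply: eq_bigr => A AS.
rewrite exchange_big/=.
have ltj B : (#|A :&: B| < h.+1)%N.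
  by rewrite ltnS -(Sh A AS) subset_leq_card// finset.subsetIl.
rewrite (partition_big (fun B => Ordinal (ltj B)) xpredT)//=.
apply: eq_bigr => j _; rewrite /overlap_count -sum1_card big_distrl/=.
apply: eq_big => [B|B /andP[BS /eqP Bj]]; first by rewrite inE.
rewrite mul1n.
have -> : (2 * h - j = #|A :|: B|)%N.
  by rewrite cardsU (Sh A AS) (Sh B BS) -Bj/=; lia.
rewrite -card_supersets// -sum1_card big_mkcond [RHS]big_mkcond/=.
by apply: eq_bigr => G _; rewrite inE; case: eqP; case: (_ \subset G).
Qed.

Lemma bin_exchange n k l :
  ('C(n, k) * 'C(n - k, l) = 'C(n, l) * 'C(n - l, k))%N.
Proof.
have [kl|kl] := leqP (k + l) n; last first.
  have [kn|kn] := leqP k n; last first.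
    by rewrite (@bin_small n k)// (@bin_small (n - l) k) ?muln0//; lia.
  have [ln|ln] := leqP l n; last first.
    by rewrite (@bin_small n l)// (@bin_small (n - k) l) ?muln0//; lia.
  by rewrite (@bin_small (n - k) l) ?(@bin_small (n - l) k) ?muln0//; lia.
apply/eqP; rewrite -(eqn_pmul2r (_ : 0 < k`! * l`! * (n - k - l)`!))%N; last first.
  by rewrite !muln_gt0 !fact_gt0.
have E1 : ('C(n, k) * (k`! * (n - k)`!) = n`!)%N by rewrite bin_fact//; lia.
have E2 : ('C(n, l) * (l`! * (n - l)`!) = n`!)%N by rewrite bin_fact//; lia.
have E3 : ('C(n - k, l) * (l`! * (n - k - l)`!) = (n - k)`!)%N.
  by rewrite bin_fact//; lia.
have E4 : ('C(n - l, k) * (k`! * (n - k - l)`!) = (n - l)`!)%N.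
  by rewrite (_ : n - k - l = n - l - k)%N ?bin_fact//; lia.
apply/eqP; transitivity n`!; first by rewrite -E1 -E3; ring.
by rewrite -E2 -E4; ring.
Qed.

(** The product of binomials is the number of h-subsets that meet A in j
    points, and the bound of overlap_switch differs from the exact recursion for
    these numbers only in having K in place of #|T| - 2 h + j + 1.  As the latter is at
    most #|T|, one factor #|T| / K per step absorbs the difference. *)
Lemma overlap_correlation (R : realFieldType) (T : finType)
    (S : {set {set T}}) (h : nat) (K : R) (A : {set T}) :
  (forall B, B \in S -> #|B| = h) -> A \in S ->
  (forall B x, B \in S -> x \in A -> x \in B -> K <= #|swaps S A B x|%:R) ->
  0 < K -> (2 * h <= #|T|)%N ->
  let a j := (#|T|%:R / K) ^+ j * ('C(h, j) * 'C(#|T| - h, h - j))%:R in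
  forall i j, (i <= j <= h)%N ->
    (overlap_count S A j)%:R * a i <= (overlap_count S A i)%:R * a j.
Proof.
move=> Sh AS HK K0 hT a i j /andP[].
elim: j => [|j IH]; first by rewrite leqn0 => /eqP ->.
rewrite leq_eqVlt => /orP[/eqP -> //|]; rewrite ltnS => ij jh.
have {}IH := IH ij (ltnW jh).
have sw := overlap_switch j Sh AS HK.
have a0 k : 0 <= a k.
  by rewrite mulr_ge0// exprn_ge0// divr_ge0// ltW.
have aE : a j.+1 * (j.+1%:R * K) * (#|T| - 2 * h + j.+1)%:R
    = a j * (h - j)%:R ^+ 2 * #|T|%:R.
  have /(congr1 (fun x => x%:R : R)) E1 :
      ('C(h, j.+1) * j.+1 = 'C(h, j) * (h - j))%N.
    by rewrite mulnC mul_bin_left mulnC.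
  have /(congr1 (fun x => x%:R : R)) E2 : ('C(#|T| - h, h - j.+1) *
       (#|T| - 2 * h + j.+1) = 'C(#|T| - h, h - j) * (h - j))%N.
    have -> : (#|T| - 2 * h + j.+1 = (#|T| - h) - (h - j.+1))%N by lia.
    have hj : (h - j = (h - j.+1).+1)%N by lia.
    by rewrite mulnC -mul_bin_left hj mulnC.
  rewrite !natrM in E1 E2; rewrite /a !natrM exprS.
  have K0' : K != 0 by rewrite gt_eqF.
  transitivity ((#|T|%:R / K) ^+ j * ('C(h, j.+1)%:R * j.+1%:R) *
    ('C(#|T| - h, h - j.+1)%:R * (#|T| - 2 * h + j.+1)%:R) * #|T|%:R).
    by field.
  by rewrite E1 E2; ring.
clearbody a.
have N0 : (0 < #|T|)%N by lia.
rewrite -(@ler_pM2r _ (j.+1%:R * K)) ?mulr_gt0//.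
apply: (@le_trans _ _ ((overlap_count S A j)%:R * (h - j)%:R ^+ 2 * a i)).
  by rewrite mulrAC ler_wpM2r.
rewrite mulrAC; apply: (@le_trans _ _
    ((overlap_count S A i)%:R * a j * (h - j)%:R ^+ 2)).
  by rewrite ler_wpM2r ?exprn_ge0.
rewrite -!mulrA ler_wpM2l//.
rewrite -(@ler_pM2r _ #|T|%:R) ?ltr0n// -aE ler_wpM2l ?mulr_ge0 ?a0 ?(ltW K0)//.
by rewrite ler_nat; lia.
Qed.

(** The correlation inequality is applied for each fixed A to the overlap
    counts, the tilted hypergeometric weights and the number of m-sets containing
    both members.  The sum of the tilted weights is at least the
    untilted sum 'C(#|T|, h); with that value, and without tilt, the squared
    mean would come out exactly. *)
Lemma sum_count_in_sqr_le (R : realFieldType) (T : finType)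
    (S : {set {set T}}) (h m : nat) (K : R) :
  (forall B, B \in S -> #|B| = h) ->
  (forall A B x, A \in S -> B \in S -> x \in A -> x \in B ->
     K <= #|swaps S A B x|%:R) ->
  0 < K <= #|T|%:R -> (2 * h <= #|T|)%N -> (h <= m <= #|T|)%N -> (0 < m)%N ->
  \sum_(G : {set T} | #|G| == m) (count_in S G)%:R ^+ 2
    <= (#|S|%:R * 'C(#|T| - h, m - h)%:R) ^+ 2 / 'C(#|T|, m)%:R *
       (1 + (#|T|%:R / K - 1) * h%:R / m%:R) ^+ h.
Proof.
move=> Sh HK /andP[K0 KT] hT /andP[hm mT] m0.
under eq_bigr do rewrite -natrX.
rewrite -natr_sum (sum_count_in_sqr mT Sh) natr_sum.
set N := #|T| in KT hT mT *.
set Z := (_ ^+ h); set B := (X in _ <= X).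
(* The bound holds for each fixed A separately. *)
have -> : B = \sum_(A in S) B / #|S|%:R.
  rewrite sumr_const -[RHS]mulr_natr; have [S0|S0] := eqVneq #|S| 0%N.
    by rewrite /B S0 !mul0r expr0n/= !mul0r.
  by rewrite divfK// pnatr_eq0.
apply: ler_sum => A AS; rewrite natr_sum.
have S0 : (0 < #|S|)%N by apply/card_gt0P; exists A.
pose F (j : 'I_h.+1) : R := (overlap_count S A j)%:R.
pose a (j : 'I_h.+1) : R :=
  (N%:R / K) ^+ j * ('C(h, j) * 'C(N - h, h - j))%:R.
pose w (j : 'I_h.+1) : R := 'C(N - (2 * h - j), N - m)%:R.
have corr : (\sum_i F i * w i) * (\sum_i a i) <= (\sum_i F i) * (\sum_i a i * w i).
  apply: correlation_sum => i j ij; last by rewrite ler_nat leq_bin2l//; lia.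
  apply: overlap_correlation => //; last by rewrite ij -ltnS /=.
  by move=> *; exact: HK.
have theta1 : 1 <= N%:R / K by rewrite ler_pdivlMr ?mul1r.
have sumF : \sum_i F i = #|S|%:R.
  rewrite -natr_sum; congr _%:R; rewrite -sum1_card.
  have ltj D : (#|A :&: D| < h.+1)%N.
    by rewrite ltnS -(Sh A AS) subset_leq_card// finset.subsetIl.
  rewrite [RHS](partition_big (fun D => Ordinal (ltj D)) xpredT)//=.
  apply: eq_bigr => j _; rewrite /overlap_count -sum1_card.
  by apply: eq_bigl => D; rewrite inE.
have suma : 'C(N, h)%:R <= \sum_i a i.
  rewrite -[N in X in X <= _](subnKC (_ : h <= N)%N); last by lia.
  rewrite -binomial.Vandermonde natr_sum; apply: ler_sum => j _.
  by rewrite ler_peMl// exprn_ege1.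
have NhE : 'C(N - h, N - m) = 'C(N - h, m - h).
  by rewrite -[RHS]bin_sub; [congr binomial|]; lia.
have sumaw : \sum_i a i * w i <= 'C(N - h, m - h)%:R *
    ('C(m, h)%:R * Z).
  have H := @overlap_pgf_le R m h (N%:R / K - 1) hm m0.
  rewrite subr_ge0 in H; have {}H := H theta1.
  apply: le_trans (ler_wpM2l _ H) => //; rewrite mulr_sumr; apply: ler_sum => j _.
  rewrite /a /w addrC subrK -mulrA [leRHS]mulrCA ler_wpM2l//.
    by rewrite exprn_ge0// (le_trans _ theta1).
  rewrite -!natrM ler_nat -mulnA.
  have -> : (N - (2 * h - j) = (N - h) - (h - j))%N by have := ltn_ord j; lia.
  rewrite bin_exchange NhE (_ : N - h - (N - m) = m - h)%N; last by lia.
  by rewrite mulnCA.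
have C0 : 0 < 'C(N, h)%:R :> R by rewrite ltr0n bin_gt0; lia.
have C1 : 0 < 'C(N, m)%:R :> R by rewrite ltr0n bin_gt0; lia.
have E : 'C(m, h)%:R * 'C(N, m)%:R = 'C(N - h, m - h)%:R * 'C(N, h)%:R :> R.
  have := bin_exchange N h (N - m).
  rewrite NhE bin_sub// subKn// => /(congr1 (fun x => x%:R : R)).
  by rewrite !natrM => H; rewrite mulrC -H mulrC.
under eq_bigr do rewrite natrM.
rewrite -(@ler_pM2r _ 'C(N, h)%:R)//.
apply: (@le_trans _ _ ((\sum_i F i * w i) * \sum_i a i)).
  by rewrite ler_wpM2l// sumr_ge0// => i _; rewrite mulr_ge0.
apply: (le_trans corr); rewrite sumF.
apply: (le_trans (ler_wpM2l _ sumaw)) => //.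
rewrite le_eqVlt; apply/orP; left; apply/eqP.
have -> : B / #|S|%:R = #|S|%:R * 'C(N - h, m - h)%:R ^+ 2 / 'C(N, m)%:R * Z.
  have S1 : #|S|%:R != 0 :> R by rewrite pnatr_eq0; lia.
  rewrite /B; move: S1 (lt0r_neq0 C1).
  move: (#|S|%:R : R) ('C(N - h, m - h)%:R : R) ('C(N, m)%:R : R) (Z) => x y z t.
  by move=> x0 z0; field; rewrite z0 x0.
apply: (mulIf (lt0r_neq0 C1)).
transitivity (#|S|%:R * 'C(N - h, m - h)%:R * Z * ('C(m, h)%:R * 'C(N, m)%:R) : R).
  by ring.
by rewrite E; field; rewrite gt_eqF.
Qed.

Lemma count_in_concentration (R : realFieldType) (T : finType)
    (S : {set {set T}}) (h m : nat) (K e : R) :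
  let mu := #|S|%:R * 'C(#|T| - h, m - h)%:R / 'C(#|T|, m)%:R in
  (forall B, B \in S -> #|B| = h) -> (0 < #|S|)%N ->
  (forall A B x, A \in S -> B \in S -> x \in A -> x \in B ->
     K <= #|swaps S A B x|%:R) ->
  0 < K <= #|T|%:R -> (2 * h <= #|T|)%N -> (h <= m <= #|T|)%N -> (0 < m)%N ->
  0 < e ->
  #|[pred G : {set T} | (#|G| == m) && (e < `|(count_in S G)%:R / mu - 1|)]|%:R
    / 'C(#|T|, m)%:R
  <= ((1 + (#|T|%:R / K - 1) * h%:R / m%:R) ^+ h - 1) / e ^+ 2.
Proof.
move=> mu Sh S0 HK K0 hT /andP[hm mT] m0 e0.
have mm := sum_count_in_sqr_le Sh HK K0 hT (introT andP (conj hm mT)) m0.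
have m1 := @sum_count_in T S h m mT Sh.
set N := #|T| in mu K0 hT mT mm m1 *.
set Z := (_ ^+ h) in mm *.
have C1 : 0 < 'C(N, m)%:R :> R by rewrite ltr0n bin_gt0.
have C2 : 0 < 'C(N - h, m - h)%:R :> R by rewrite ltr0n bin_gt0; lia.
have S1 : 0 < #|S|%:R :> R by rewrite ltr0n.
have mu0 : 0 < mu by rewrite divr_gt0// mulr_gt0.
have sum1 : \sum_(G : {set T} | #|G| == m) (count_in S G)%:R = 'C(N, m)%:R * mu.
  have -> : 'C(N, m)%:R * mu = #|S|%:R * 'C(N - h, m - h)%:R.
    by rewrite mulrC divfK// gt_eqF.
  rewrite -natr_sum m1 natrM -[X in _ = _ * X%:R]bin_sub; last by lia.
  by congr (_ * 'C(_, _)%:R); lia.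
have sum0 : \sum_(G : {set T} | #|G| == m) (1 : R) = 'C(N, m)%:R.
  rewrite sumr_const -card_draws; congr (_ *+ _).
  by apply: eq_card => G; rewrite inE.
have var : \sum_(G : {set T} | #|G| == m) ((count_in S G)%:R / mu - 1) ^+ 2
    <= 'C(N, m)%:R * (Z - 1).
  rewrite (eq_bigr (fun G : {set T} => (count_in S G)%:R ^+ 2 / mu ^+ 2
     - ((count_in S G)%:R * (2 / mu) - 1))); last first.
    move=> G _; move: (count_in S G)%:R (mu) (lt0r_neq0 mu0) => x y y0.
    by field.
  rewrite sumrB sumrB -!mulr_suml sum1 sum0.
  have -> : 'C(N, m)%:R * mu * (2 / mu) - 'C(N, m)%:R = 'C(N, m)%:R :> R.
    by move: ('C(N, m)%:R) (mu) (lt0r_neq0 mu0) => x y y0; field.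
  rewrite mulrBr mulr1 lerD2r ler_pdivrMr ?exprn_gt0//.
  apply: (le_trans mm); rewrite le_eqVlt; apply/orP; left; apply/eqP.
  by rewrite /mu; field; rewrite gt_eqF.
rewrite ler_pdivrMr// mulrAC ler_pdivlMr ?exprn_gt0// [leRHS]mulrC.
apply: le_trans var; rewrite -sum1_card natr_sum mulr_suml.
rewrite big_mkcond [leRHS]big_mkcond/=; apply: ler_sum => G _.
rewrite inE; case: eqP => //= _; case: ifPn => [H|_]; last exact: sqr_ge0.
rewrite mul1r -[leRHS]real_normK ?num_real//.
by rewrite ler_pXn2r ?nnegrE ?normr_ge0 ?(ltW e0) ?(ltW H).
Qed.

(** * Triangle-free graphs of bounded degree *)

Lemma card_edge n : #|{: edge n}| = 'C(n, 2).
Proof.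
rewrite card_sig -[n in RHS]card_ord -card_draws.
by rewrite cardsE.
Qed.

Lemma adjC n (G : graph n) x y : adj G x y = adj G y x.
Proof.
by apply: eq_existsb => e; rewrite finset.setUC.
Qed.

Lemma adj_neq n (G : graph n) x y : adj G x y -> x != y.
Proof.
move=> /existsP[e /andP[_ /eqP eE]]; apply/eqP => xy.
by have := valP e; rewrite /= eE xy cards2 eqxx.
Qed.

Lemma adjU1 n (G : graph n) e x y :
  adj (e |: G) x y = (val e == [set x; y]%SET) || adj G x y.
Proof.
apply/existsP/orP => [[f /andP[]]|[eE|/existsP[f /andP[fG fE]]]].
- rewrite in_setU1 => /orP[/eqP ->|fG fE]; first by left.
  by right; apply/existsP; exists f; rewrite fG.
- by exists e; rewrite in_setU1 eqxx.
- by exists f; rewrite in_setU1 fG orbT.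
Qed.

Lemma sub_adj n (G H : graph n) x y : G \subset H -> adj G x y -> adj H x y.
Proof.
move=> /fintype.subsetP GH /existsP[e /andP[eG eE]]; apply/existsP; exists e.
by rewrite GH.
Qed.

Lemma sub_triangle_free n (G H : graph n) :
  G \subset H -> triangle_free H -> triangle_free G.
Proof.
move=> GH /forallP tf; apply/forallP => x; apply/forallP => y; apply/forallP => z.
have /forallP/(_ y)/forallP/(_ z) := tf x.
by apply: contra => /and3P[*]; apply/and3P; split; exact: sub_adj GH _.
Qed.

Lemma sub_degree n (G H : graph n) x : G \subset H -> (degree G x <= degree H x)%N.
Proof.
by move=> GH; apply/subset_leq_card/fintype.subsetP => y; rewrite !inE; exact: sub_adj.
Qed.

(** The map sending a neighbour y of x to the edge {x, y} is injective; it is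
    valued in an option type because the pair need not be an edge. *)
Lemma degree_incident n (G : graph n) x :
  (degree G x <= #|[set e in G | x \in val e]%SET|)%N.
Proof.
pose f y : option (edge n) := insub [set x; y]%SET.
rewrite -(card_imset _ (@Some_inj _)) {1}/degree -(@card_in_imset _ _ f); last first.
  move=> y z; rewrite !inE => /adj_neq xy /adj_neq xz; rewrite /f.
  case: insubP => [u _ uE|]; last by rewrite cards2 xy.
  case: insubP => [v _ vE|]; last by rewrite cards2 xz.
  move=> [uv]; have : y \in [set x; z]%SET.
    by rewrite -vE -uv uE !inE eqxx orbT.
  by rewrite !inE eq_sym (negbTE xy) => /eqP.
apply/subset_leq_card/fintype.subsetP => _ /imsetP[y + ->].
rewrite inE => /existsP[e /andP[eG /eqP eE]]; apply/imsetP; exists e.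
  by rewrite inE eG eE !inE eqxx.
by rewrite /f -eE valK.
Qed.

Lemma sum_degree_le n (G : graph n) : (\sum_x degree G x <= 2 * #|G|)%N.
Proof.
apply: (@leq_trans (\sum_x \sum_(e in G) (x \in val e))).
  apply: leq_sum => x _; apply: leq_trans (degree_incident G x) _.
  rewrite -sum1_card big_mkcond [leqRHS]big_mkcond; apply: leq_sum => e _.
  by rewrite inE; case: (e \in G); case: (x \in _).
rewrite exchange_big/= mulnC -sum_nat_const; apply: leq_sum => e _.
rewrite -[leqRHS](eqP (valP e)) -sum1_card [leqRHS]big_mkcond.
by apply: leq_sum => x _; case: (x \in _).
Qed.

Definition closing n (G : graph n) : {set edge n} :=
  [set e : edge n | [exists x, exists y, exists z,
             [&& val e == [set x; y]%SET, adj G z x & adj G z y]]]%SET.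

Definition saturated n (G : graph n) (D : nat) : {set edge n} :=
  [set e : edge n | [exists x, (x \in val e) && (D <= degree G x)%N]]%SET.

(** A triangle of e |: G contains e at most once, because it has three distinct
    vertices; if it contains e, its other two edges lie in G and e is closing. *)
Lemma triangle_freeU1 n (G : graph n) e :
  triangle_free G -> e \notin closing G -> triangle_free (e |: G).
Proof.
move=> /forallP tf eG.
have ncl x y z : val e = [set x; y]%SET -> adj G z x -> adj G z y -> False.
  move=> eE zx zy; move/negP: eG; apply; rewrite inE.
  apply/existsP; exists x; apply/existsP; exists y; apply/existsP; exists z.
  by rewrite eE eqxx zx.
apply/forallP => x; apply/forallP => y; apply/forallP => z.
apply/negP => /and3P[xy yz xz].
have [xy' yz' xz'] := And3 (adj_neq xy) (adj_neq yz) (adj_neq xz).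
(* No two sides of a triangle are the same edge. *)
have two (u v w : 'I_n) : u != v -> u != w ->
    val e = [set u; v]%SET -> val e = [set v; w]%SET -> False.
  move=> uv uw -> /setP/(_ u); rewrite !inE eqxx/= (negbTE uv) (negbTE uw).
  by [].
move: xy yz xz; rewrite !adjU1.
move=> /orP[/eqP exy|xy] /orP[/eqP eyz|yz] /orP[/eqP exz|xz].
- exact: two exy eyz.
- exact: two exy eyz.
- by apply: (two y x z) exz => //; rewrite 1?eq_sym// finset.setUC.
- by apply: ncl exy _ _; rewrite adjC; [exact: xz|exact: yz].
- by apply: (two x z y) exz _ => //; rewrite finset.setUC.
- by apply: ncl eyz _ _; [exact: xy|exact: xz].
- by apply: ncl exz _ _; [rewrite adjC; exact: xy|exact: yz].
- by have /forallP/(_ y)/forallP/(_ z)/negP[] := tf x; rewrite xy yz.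
Qed.

Lemma degreeU1 n (G : graph n) e D :
  (forall x, degree G x <= D)%N -> e \notin saturated G D ->
  forall x, (degree (e |: G) x <= D)%N.
Proof.
move=> dG eG x; have [xe|xe] := boolP (x \in val e); last first.
  apply: leq_trans (dG x); apply/subset_leq_card/fintype.subsetP => y.
  rewrite !inE adjU1 => /orP[/eqP eE|//].
  by rewrite eE !inE eqxx in xe.
have dx : (degree G x < D)%N.
  rewrite ltnNge; apply: contra eG => Dx; rewrite inE.
  by apply/existsP; exists x; rewrite xe.
apply: (@leq_trans (degree G x + 1)); last by rewrite addn1.
pose N := [set y | val e == [set x; y]]%SET.
apply: (@leq_trans #|[set y | adj G x y]%SET :|: N|).
  by apply/subset_leq_card/fintype.subsetP => y; rewrite !inE adjU1 orbC.
apply: leq_trans (leq_of_leqif (leq_card_setU _ _)) _.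
rewrite leq_add//; first by rewrite /degree cardsE.
apply/card_le1_eqP => y z; rewrite !inE => /eqP ey /eqP ez.
have xy : x != y.
  by apply/eqP => xy; have := valP e; rewrite /= ey xy cards2 eqxx.
have : y \in [set x; z]%SET by rewrite -ez ey !inE eqxx orbT.
by rewrite !inE eq_sym (negbTE xy) => /eqP.
Qed.

(** Each closing edge comes from a vertex and an ordered pair of its neighbours. *)
Lemma card_closing n (G : graph n) D :
  (forall x, degree G x <= D)%N -> (#|closing G| <= 2 * #|G| * D)%N.
Proof.
move=> dG.
pose Q := [set t : 'I_n * ('I_n * 'I_n) | adj G t.1 t.2.1 && adj G t.1 t.2.2]%SET.
pose f (t : 'I_n * ('I_n * 'I_n)) : option (edge n) :=
  insub [set t.2.1; t.2.2]%SET.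
apply: (@leq_trans #|Q|).
  rewrite -(card_imset _ (@Some_inj _)).
  apply: (leq_trans _ (leq_imset_card f Q)); apply/subset_leq_card/fintype.subsetP.
  move=> _ /imsetP[e + ->]; rewrite inE.
  move=> /existsP[x /existsP[y /existsP[z /and3P[/eqP eE zx zy]]]].
  apply/imsetP; exists (z, (x, y)); first by rewrite inE zx.
  by rewrite /f/= -eE valK.
rewrite -sum1_card (eq_bigl (fun t : 'I_n * ('I_n * 'I_n) => true &&
    (adj G t.1 t.2.1 && adj G t.1 t.2.2))); last by move=> t; rewrite inE.
rewrite -(pair_big_dep xpredT (fun z xy => adj G z xy.1 && adj G z xy.2)
  (fun _ _ => 1%N))/=.
apply: (@leq_trans (\sum_x degree G x * D)); last first.
  by rewrite -big_distrl leq_mul2r sum_degree_le orbT.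
apply: leq_sum => z _.
rewrite -(pair_big (adj G z) (adj G z) (fun _ _ => 1%N))/=.
by rewrite sum_nat_const sum1_card leq_mul2l dG orbT.
Qed.

Lemma card_incident n (x : 'I_n) : (#|[set e : edge n | x \in val e]%SET| <= n)%N.
Proof.
pose f y : option (edge n) := insub [set x; y]%SET.
rewrite -[leqRHS]card_ord -(card_imset _ (@Some_inj _)).
apply: (leq_trans _ (leq_imset_card f 'I_n)).
apply/subset_leq_card/fintype.subsetP => _ /imsetP[e + ->]; rewrite inE => xe.
have /cards2P[u [v [uv eE]]] : #|val e| == 2 by exact: (valP e).
move: xe; rewrite eE !inE => /orP[]/eqP xE; apply/imsetP.
  by exists v => //; rewrite /f xE -eE valK.
by exists u => //; rewrite /f xE finset.setUC -eE valK.
Qed.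

(** At most 2 #|G| / D vertices have degree at least D, and each of them lies in
    at most n edges. *)
Lemma card_saturated n (G : graph n) D :
  (#|saturated G D| * D <= 2 * #|G| * n)%N.
Proof.
pose L := [set x | (D <= degree G x)%N]%SET.
apply: (@leq_trans (#|L| * n * D)); last first.
  rewrite mulnAC leq_mul2r; apply/orP; right.
  apply: leq_trans (sum_degree_le G); rewrite -sum_nat_const.
  by rewrite big_mkcond; apply: leq_sum => x _; rewrite inE; case: ifP.
rewrite leq_mul2r; apply/orP; right; rewrite -sum_nat_const.
apply: (@leq_trans (\sum_(x in L) \sum_(e : edge n) (x \in val e))).
  rewrite exchange_big/= -sum1_card big_mkcond; apply: leq_sum => e _.
  rewrite inE; case: existsP => // -[x /andP[xe Dx]].
  by rewrite (bigD1 x) ?inE//= xe.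
apply: leq_sum => x _; apply: leq_trans (card_incident x).
by rewrite -sum1_card [leqRHS]big_mkcond; apply: leq_sum => e _; rewrite inE.
Qed.

(** Bounds the number of edges that may not be inserted: those of the two given
    graphs, those closing a triangle and those meeting a vertex of degree D. *)
Definition blocked_bound (R : realFieldType) (n h D : nat) : R :=
  2 * h%:R + 2 * h%:R * D%:R + 2 * h%:R * n%:R / D%:R.

Lemma card_blocked (R : realFieldType) n h D (A B : graph n) : (0 < D)%N ->
  (#|A| <= h)%N -> (#|B| <= h)%N -> (forall x, degree B x <= D)%N ->
  #|A :|: B :|: closing B :|: saturated B D|%:R <= blocked_bound R n h D.
Proof.
move=> D0 Ah Bh dB.
apply: (@le_trans _ _ ((#|A| + #|B| + #|closing B|)%N%:R
    + #|saturated B D|%:R)).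
  rewrite -natrD ler_nat; apply: leq_trans (leq_of_leqif (leq_card_setU _ _)) _.
  rewrite leq_add2r; apply: leq_trans (leq_of_leqif (leq_card_setU _ _)) _.
  by rewrite leq_add2r; exact: leq_of_leqif (leq_card_setU _ _).
rewrite /blocked_bound lerD//.
  rewrite -!natrM -natrD ler_nat leq_add//.
    by rewrite mul2n -addnn leq_add.
  by apply: leq_trans (card_closing dB) _; rewrite leq_mul2r leq_mul2l Bh !orbT.
rewrite ler_pdivlMr ?ltr0n// -!natrM ler_nat.
apply: leq_trans (card_saturated B D) _.
by rewrite leq_mul2r leq_mul2l Bh !orbT.
Qed.

(** Stated for a subgraph C of B so that it covers both an exchange, with C equal
    to B minus an edge, and a plain insertion, with C = B. *)
Lemma tf_family_addition n h D (B : graph n) y :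
  triangle_free B -> (forall x, degree B x <= D)%N -> (#|B| <= h)%N ->
  y \notin B -> y \notin closing B -> y \notin saturated B D ->
  forall C : graph n, C \subset B ->
    y |: C \in tf_family n #|C|.+1 D.
Proof.
move=> tB dB Bh yB yc ys C CB.
have CyBy : y |: C \subset y |: B by rewrite finset.setUS.
rewrite inE (sub_triangle_free CyBy (triangle_freeU1 tB yc))/= cardsU1.
have -> : y \notin C by apply: contra yB; apply/fintype.subsetP.
rewrite add1n eqxx/=; apply/forallP => x.
exact: leq_trans (sub_degree x CyBy) (degreeU1 dB ys x).
Qed.

Lemma card_swaps_tf_family (R : realFieldType) n h D (A B : graph n) x :
  (0 < D)%N -> A \in tf_family n h D -> B \in tf_family n h D -> x \in B ->
  'C(n, 2)%:R - blocked_bound R n h D <= #|swaps (tf_family n h D) A B x|%:R.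
Proof.
move=> D0; rewrite !inE => /and3P[_ /eqP Ah _] /and3P[tB /eqP Bh /forallP dB] xB.
rewrite lerBlDr -card_edge.
rewrite -(cardsC (A :|: B :|: closing B :|: saturated B D)) natrD addrC.
rewrite lerD//; last by rewrite card_blocked ?Ah ?Bh.
rewrite ler_nat; apply/subset_leq_card/fintype.subsetP => y.
rewrite finset.in_setC !finset.in_setU !negb_or -!andbA => /and4P[yA yB yc ys].
rewrite inE yA yB/=.
have Bx : (#|B :\ x|.+1 = h)%N by rewrite -Bh (cardsD1 x B) xB.
have := tf_family_addition tB dB (leqnn _) yB yc ys (subD1set B x).
by rewrite Bx.
Qed.

(** Greedy construction: as long as there are fewer than h edges, the blocked
    edges do not exhaust all edges, so another one can be inserted. *)
Lemma tf_family_gt0 (R : realFieldType) n h D : (0 < D)%N ->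
  blocked_bound R n h D < 'C(n, 2)%:R -> (0 < #|tf_family n h D|)%N.
Proof.
move=> D0 hb; suff : forall k, (k <= h)%N -> (0 < #|tf_family n k D|)%N by apply.
elim=> [_|k IH kh].
  have adj0 x y : @adj n finset.set0 x y = false.
    by apply/existsP => -[e]; rewrite inE.
  apply/card_gt0P; exists finset.set0; rewrite inE cards0 eqxx/=.
  apply/andP; split; last first.
    by apply/forallP => x; rewrite /degree eq_card0// => y; rewrite !inE adj0.
  apply/forallP => x; apply/forallP => y; apply/forallP => z.
  by rewrite adj0.
have /card_gt0P[B] := IH (ltnW kh).
rewrite inE => /and3P[tB /eqP Bk /forallP dB].
have Bh : (#|B| <= h)%N by rewrite Bk ltnW.
pose X := B :|: B :|: closing B :|: saturated B D.
have : (#|X| < #|{: edge n}|)%N.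
  rewrite card_edge -(ltr_nat R); apply: le_lt_trans hb.
  exact: card_blocked.
rewrite -(cardsC X) -[X in (X < _)%N]addn0 ltn_add2l => /card_gt0P[y].
rewrite finset.in_setC !finset.in_setU !negb_or -!andbA => /and4P[_ yB yc ys].
apply/card_gt0P; exists (y |: B).
by have := tf_family_addition tB dB Bh yB yc ys (subxx B); rewrite Bk.
Qed.

(** Here K = N - blocked_bound is at least N / 2, so N / K - 1 is at most
    2 blocked_bound / N. *)
Lemma tf_count_concentration (R : realType) n h D k (e : R) :
  let N := 'C(n, 2) in
  (0 < D)%N -> blocked_bound R n h D <= N%:R / 2 -> (2 * h <= N)%N ->
  (h <= k <= N)%N -> (0 < k)%N -> 0 < e ->
  gnm R k [pred G : graph n |
      e < `|(tf_count h D G)%:R / mu_ R k h D n - 1|]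
  <= ((1 + 2 * blocked_bound R n h D / N%:R * h%:R / k%:R) ^+ h - 1) / e ^+ 2.
Proof.
move=> N D0 hb hN hk k0 e0.
have b0 : 0 <= blocked_bound R n h D.
  by rewrite /blocked_bound !addr_ge0// ?divr_ge0// !mulr_ge0.
have N0 : 0 < N%:R :> R.
  by rewrite ltr0n; case/andP: hk; lia.
have S0 : (0 < #|tf_family n h D|)%N.
  by apply: (@tf_family_gt0 R) => //; apply: le_lt_trans hb _; lra.
have Sh B : B \in tf_family n h D -> #|B| = h.
  by rewrite inE => /and3P[_ /eqP].
pose K : R := N%:R - blocked_bound R n h D.
have K0 : 0 < K by rewrite /K; lra.
have HK A B x : A \in tf_family n h D -> B \in tf_family n h D -> x \in A ->
    x \in B -> K <= #|swaps (tf_family n h D) A B x|%:R.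
  by move=> AS BS _; exact: card_swaps_tf_family.
have KN : 0 < K <= N%:R by rewrite K0/= /K; lra.
have := @count_in_concentration R (edge n) (tf_family n h D) h k K e Sh S0 HK.
rewrite card_edge -/N => /(_ KN hN hk k0 e0).
have cardk : #|[pred G : graph n | #|G| == k]| = 'C(N, k).
  by rewrite /N -(card_edge n) -card_draws; apply: eq_card => G; rewrite !inE.
rewrite /gnm cardk => conc; apply: le_trans conc _; rewrite ler_pM2r ?invr_gt0 ?exprn_gt0//.
have d0 : 0 <= N%:R / K - 1.
  by rewrite subr_ge0 ler_pdivlMr// mul1r /K; lra.
have k0' : 0 < k%:R :> R by rewrite ltr0n.
rewrite lerD2r lerXn2r// ?nnegrE.
- by rewrite addr_ge0// divr_ge0// mulr_ge0.
- by rewrite addr_ge0// divr_ge0// mulr_ge0// divr_ge0// mulr_ge0.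
rewrite lerD2l !ler_wpM2r ?invr_ge0 ?(ltW k0') ?ler0n// -subr_ge0.
have -> : 2 * blocked_bound R n h D / N%:R - (N%:R / K - 1)
    = blocked_bound R n h D * (N%:R - 2 * blocked_bound R n h D) / (N%:R * K).
  rewrite /K; move: N0 K0; rewrite /K; move: (N%:R : R) (blocked_bound R n h D).
  by move=> x y x0 xy; field; rewrite (gt_eqF x0) (gt_eqF xy).
by rewrite divr_ge0 ?mulr_ge0 ?(ltW N0) ?(ltW K0)//; lra.
Qed.

(** * The normal distribution function *)

Local Open Scope classical_set_scope.
Local Open Scope ring_scope.

Definition std_cdf (R : realType) (x : R) : R :=
  fine (normal_prob 0 1 `]-oo, x]%classic).

Lemma std_cdf_ge0 (R : realType) (x : R) : 0 <= std_cdf x.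
Proof. exact/fine_ge0. Qed.

Lemma std_cdf_le1 (R : realType) (x : R) : std_cdf x <= 1.
Proof.
rewrite /std_cdf -lee_fin fineK ?fin_num_measure//.
exact: (@probability_le1 _ _ R (normal_prob 0 1)).
Qed.

Lemma std_cdfB (R : realType) (a b : R) : a <= b ->
  (std_cdf b - std_cdf a)%:E = normal_prob 0 1 `]a, b]%classic.
Proof.
move=> ab; rewrite EFinB /std_cdf !fineK ?fin_num_measure//.
have -> : (`]-oo, b] = `]-oo, a] `|` `]a, b] :> set R)%classic.
  rewrite -itv_bndbnd_setU//.
rewrite measureU//; last first.
  by apply/seteqP; split => x //=; rewrite !in_itv/= => -[xa /andP[]]; rewrite ltNge xa.
by rewrite addeAC subee ?add0e// fin_num_measure.
Qed.

(** Bounding the integral of the density over an interval by its length times the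
    extreme values of the density. *)
Lemma std_cdf_itv (R : realType) (a b l u : R) : a <= b -> 0 <= l ->
  (forall t, a <= t <= b -> l <= normal_pdf 0 1 t <= u) ->
  l * (b - a) <= std_cdf b - std_cdf a <= u * (b - a).
Proof.
move=> ab l0 lu.
have mu_ab : lebesgue_measure `]a, b]%classic = (b - a)%:E :> \bar R.
  rewrite lebesgue_measure_itv/= lte_fin; case: ltgtP ab => // [->] _.
  by rewrite subrr.
have cstE (r : R) :
    (\int[lebesgue_measure]_(x in `]a, b]) r%:E)%E = (r * (b - a))%:E.
  by rewrite integral_cst//= mu_ab.
rewrite -!lee_fin std_cdfB// /normal_prob -!cstE.
apply/andP; split.
  apply: ge0_le_integral => //=.
  - by apply/measurable_EFinP; apply: measurable_funTS; exact: measurable_normal_pdf.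
  - move=> x; rewrite in_itv/= => /andP[/ltW ax xb].
    by rewrite lee_fin; have /andP[] := lu x (introT andP (conj ax xb)).
apply: ge0_le_integral => //=.
- by move=> x _; rewrite lee_fin normal_pdf_ge0.
- by apply/measurable_EFinP; apply: measurable_funTS; exact: measurable_normal_pdf.
- move=> x; rewrite in_itv/= => /andP[/ltW ax xb].
  by rewrite lee_fin; have /andP[] := lu x (introT andP (conj ax xb)).
Qed.

Lemma std_cdf_nondecreasing (R : realType) (a b : R) : a <= b ->
  std_cdf a <= std_cdf b.
Proof. by move=> ab; rewrite -subr_ge0 -lee_fin std_cdfB. Qed.

Lemma std_pdfE (R : realType) (t : R) :
  normal_pdf 0 1 t = normal_peak 1 * expR (- (t ^+ 2) / 2).
Proof.
by rewrite normal_pdfE ?oner_neq0// /normal_fun subr0 expr1n.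
Qed.

Lemma normal_peak1_le1 (R : realType) : normal_peak (1 : R) <= 1.
Proof.
rewrite /normal_peak expr1n mul1r invf_le1.
  rewrite -[leLHS]sqrtr1 ler_wsqrtr//.
  have := pi_ge2 R; rewrite mulr2n; lra.
by rewrite sqrtr_gt0 mulrn_wgt0// pi_gt0.
Qed.

Lemma std_cdf_lipschitz (R : realType) (a b : R) : a <= b ->
  std_cdf b - std_cdf a <= b - a.
Proof.
move=> ab; have pdf01 t : a <= t <= b -> 0 <= normal_pdf 0 1 t <= (1 : R).
  move=> _; rewrite normal_pdf_ge0/=.
  exact: le_trans (normal_pdf_ub _ _ (oner_neq0 R)) (normal_peak1_le1 R).
by have /andP[_] := std_cdf_itv ab (lexx 0) pdf01; rewrite mul1r.
Qed.

Lemma std_cdf_shift (R : realType) (y r : R) : 0 <= r ->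
  std_cdf (y + r) - std_cdf y <= r.
Proof.
move=> r0; have := @std_cdf_lipschitz R y (y + r).
by rewrite lerDl r0 [y + r - y]addrC addKr; apply.
Qed.

Lemma std_cdf_tails (R : realType) (e : R) : 0 < e ->
  exists A0, forall A, A0 <= A -> std_cdf (- A) <= e /\ 1 - e <= std_cdf A.
Proof.
move=> e0.
pose idTR : measurableTypeR R -> R := idfun.
pose mid := @isMeasurableFun.Build _ _ _ _ idTR (@measurable_id _ _ setT).
pose X : {RV (normal_prob 0 1 : probability (measurableTypeR R) R) >-> R} :=
  HB.pack idTR mid.
have XE r : cdf X r = (std_cdf r)%:E.
  by rewrite /std_cdf fineK ?fin_num_measure.
have top : std_cdf r @[r --> +oo] --> (1 : R).
  have := @cvg_cdfy1 _ _ _ _ X; rewrite (funext XE : cdf X = _).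
  exact: fine_cvg.
have bot : std_cdf r @[r --> -oo] --> (0 : R).
  have := @cvg_cdfNy0 _ _ _ _ X; rewrite (funext XE : cdf X = _).
  exact: fine_cvg.
have [M [_ HM]] : \forall r \near +oo, 1 - e <= std_cdf r.
  by apply: (cvgr_ge _ top); rewrite ltrBlDr ltrDl.
have [L [_ HL]] : \forall r \near -oo, std_cdf r <= e.
  exact: (cvgr_le _ bot).
exists (Num.max (M + 1) (- L + 1)) => A; rewrite ge_max => /andP[MA LA].
by split; [apply: HL|apply: HM]; lra.
Qed.

(** * The central limit theorem for the binomial distribution *)

Lemma binomial_pmfE (R : realType) N (p : R) k :
  binomial_pmf N p k = 'C(N, k)%:R * p ^+ k * (1 - p) ^+ (N - k).
Proof. by rewrite /binomial_pmf -mulr_natl mulrA. Qed.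

Lemma sum_binomial_pmfS (R : realType) N (p : R) (f : nat -> R) :
  \sum_(k < N.+2) binomial_pmf N.+1 p k * f k =
  \sum_(k < N.+1) binomial_pmf N p k * (p * f k.+1 + (1 - p) * f k).
Proof.
rewrite big_ord_recl /=.
transitivity (\sum_(k < N.+2) (1 - p) *
      ('C(N, k)%:R * p ^+ k * (1 - p) ^+ (N - k)) * f k
    + \sum_(k < N.+1) p * binomial_pmf N p k * f k.+1); last first.
  rewrite big_ord_recr/= bin_small// !mul0r mulr0 mul0r addr0.
  rewrite -big_split/=; apply: eq_bigr => k _.
  by rewrite binomial_pmfE; ring.
rewrite [in RHS]big_ord_recl/= -addrA; congr (_ + _).
  by rewrite binomial_pmfE !bin0 !subn0 exprS; ring.
rewrite -big_split/=; apply: eq_bigr => k _.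
rewrite !binomial_pmfE binS natrD /bump/= add1n subSS.
rewrite -[RHS]mulrDl; congr (_ * _).
have [kN|kN] := ltnP k N; last first.
  by rewrite (@bin_small N k.+1) ?exprS; [ring|lia].
rewrite (_ : N - k = (N - k.+1).+1)%N; last by lia.
by rewrite !exprS; ring.
Qed.

Lemma sum_binomial_pmf (R : realType) N (p : R) :
  \sum_(k < N.+1) binomial_pmf N p k = 1.
Proof.
rewrite -[RHS](expr1n _ N) -{1}(subrK p 1) exprDn.
by apply: eq_bigr => k _; rewrite binomial_pmfE -mulr_natl; ring.
Qed.

(** Centred at an arbitrary point a, because the induction on N shifts the
    centre. *)
Lemma binomial_second_moment (R : realType) N (p a : R) :
  \sum_(k < N.+1) binomial_pmf N p k * (k%:R - a) ^+ 2
    = N%:R * p * (1 - p) + (N%:R * p - a) ^+ 2.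
Proof.
elim: N a => [|N IH] a.
  by rewrite big_ord_recl big_ord0 binomial_pmfE /= !expr0 bin0; ring.
rewrite (@sum_binomial_pmfS R N p (fun k => (k%:R - a) ^+ 2)).
transitivity (p * (\sum_(k < N.+1) binomial_pmf N p k * (k%:R - (a - 1)) ^+ 2)
   + (1 - p) * (\sum_(k < N.+1) binomial_pmf N p k * (k%:R - a) ^+ 2)).
  rewrite !mulr_sumr -big_split/=; apply: eq_bigr => k _.
  by rewrite -natr1; ring.
by rewrite !IH -natr1; ring.
Qed.

Lemma binomial_tail (R : realType) N (p t : R) : 0 <= p <= 1 -> 0 < t ->
  \sum_(k < N.+1 | t <= `|k%:R - N%:R * p|) binomial_pmf N p k
    <= N%:R * p * (1 - p) / t ^+ 2.
Proof.
move=> p01 t0; rewrite ler_pdivlMr ?exprn_gt0//.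
have -> : N%:R * p * (1 - p)
    = \sum_(k < N.+1) binomial_pmf N p k * (k%:R - N%:R * p) ^+ 2.
  by rewrite binomial_second_moment subrr expr0n/= addr0.
rewrite mulr_suml big_mkcond; apply: ler_sum => k _; case: ifPn => tk.
  rewrite ler_wpM2l ?binomial_pmf_ge0// -[leRHS]real_normK ?num_real//.
  by rewrite ler_pXn2r ?nnegrE ?(ltW t0).
by rewrite mulr_ge0 ?binomial_pmf_ge0 ?sqr_ge0.
Qed.

(** Follows from exp(-x + 2 x^2) >= 1 - x + 2 x^2, since
    (1 - x + 2 x^2) (1 + x) = 1 + x^2 (1 + 2 x) >= 1. *)
Lemma expR_sub_sqr_le (R : realType) (x : R) : - (1 / 2) <= x ->
  expR (x - 2 * x ^+ 2) <= 1 + x.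
Proof.
move=> x2; have := expR_ge1Dx (- x + 2 * x ^+ 2).
rewrite (_ : x - 2 * x ^+ 2 = - (- x + 2 * x ^+ 2)); last by ring.
rewrite expRN invf_ple ?posrE ?expR_gt0//; last by lra.
apply: le_trans; rewrite -[X in X <= _]mul1r ler_pdivrMr; last by lra.
have := mulr_ge0 (sqr_ge0 x) (_ : 0 <= 1 + 2 * x).
have -> : (1 + (- x + 2 * x ^+ 2)) * (1 + x) = 1 + x ^+ 2 * (1 + 2 * x) by ring.
by rewrite lerDl; apply; lra.
Qed.

Lemma expR_le1D2 (R : realType) (r : R) : 0 <= r -> r <= 1 / 2 ->
  expR r <= 1 + 2 * r.
Proof.
move=> r0 r1; have := expR_ge1Dx (- r); rewrite expRN => ex.
have inv0 := expR_gt0 r.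
have Er : (1 - r) * expR r <= 1 by rewrite -ler_pdivlMr// div1r.
have r12 : 0 <= r * (1 - 2 * r) by rewrite mulr_ge0//; lra.
have : (1 - r) * expR r <= (1 - r) * (1 + 2 * r) by lra.
by rewrite ler_pM2l//; lra.
Qed.

Lemma binomial_param01 (R : realType) N m (p : R) : (0 < m < N)%N ->
  m%:R = p * N%:R -> 0 < p < 1.
Proof.
move=> /andP[m0 mN] pN; have N0 : 0 < N%:R :> R by rewrite ltr0n; lia.
have -> : p = m%:R / N%:R by rewrite pN mulfK// gt_eqF.
by apply/andP; split; [rewrite divr_gt0// ltr0n|rewrite ltr_pdivrMr// mul1r ltr_nat].
Qed.

(** The identity 1 / (N p (1 - p)) = 1 / m + 1 / (N - m): it makes the linear terms
    in the logarithm of binomial_pmf_ratio add up to that of the Gaussian. *)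
Lemma inv_variance (R : realType) N m (p s : R) : (0 < m < N)%N ->
  m%:R = p * N%:R -> s ^+ 2 = N%:R * p * (1 - p) ->
  (s ^+ 2)^-1 = m%:R^-1 + (N - m)%:R^-1.
Proof.
move=> /andP[m0 mN] pN ->.
have N0 : 0 < N%:R :> R by rewrite ltr0n; lia.
have M0 : 0 < m%:R :> R by rewrite ltr0n.
have Q0 : 0 < (N - m)%:R :> R by rewrite ltr0n; lia.
have -> : p = m%:R / N%:R by rewrite pN mulfK// gt_eqF.
move: Q0; rewrite natrB ?(ltnW mN)//; move: M0 N0.
move: (m%:R : R) (N%:R : R) => x y x0 y0 xy.
by field; rewrite !gt_eqF//= subr_gt0 -subr_gt0.
Qed.

Lemma binomial_pmf_ratio (R : realType) N m (p : R) k : (0 < m < N)%N ->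
  m%:R = p * N%:R -> (k < N)%N ->
  binomial_pmf N p k.+1 * (1 + (k%:R + 1 - m%:R) / m%:R)
    = binomial_pmf N p k * (1 - (k%:R - m%:R) / (N - m)%:R).
Proof.
move=> /andP[m0 mN] pN kN.
have N0 : 0 < N%:R :> R by rewrite ltr0n; lia.
have M0 : 0 < m%:R :> R by rewrite ltr0n.
have Q0 : 0 < (N - m)%:R :> R by rewrite ltr0n; lia.
have Nm : (N - m)%:R = N%:R - m%:R :> R by rewrite natrB// ltnW.
have pE : p = m%:R / N%:R by rewrite pN mulfK// gt_eqF.
have E : 'C(N, k.+1)%:R * (k%:R + 1) = 'C(N, k)%:R * (N%:R - k%:R) :> R.
  by rewrite natr1 -natrB ?(ltnW kN)// -!natrM mulnC mul_bin_left mulnC.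
have -> : 1 + (k%:R + 1 - m%:R) / m%:R = (k%:R + 1) / m%:R :> R.
  by field; rewrite gt_eqF.
have -> : 1 - (k%:R - m%:R) / (N - m)%:R = (N%:R - k%:R) / (N - m)%:R :> R.
  by move: Q0; rewrite Nm => q; field; rewrite gt_eqF.
rewrite !binomial_pmfE (_ : N - k = (N - k.+1).+1)%N; last by lia.
rewrite !exprS.
transitivity (p ^+ k * (1 - p) ^+ (N - k.+1) * (p / m%:R) *
    ('C(N, k.+1)%:R * (k%:R + 1))); first by ring.
rewrite E; have -> : p / m%:R = (1 - p) / (N - m)%:R.
  rewrite pE; move: M0 Q0 N0; rewrite Nm.
  move: (m%:R : R) (N%:R : R) => x y x0 y0 xy.
  by field; rewrite !gt_eqF//= subr_gt0 -subr_gt0.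
by ring.
Qed.

Lemma window_ratio_small (R : realType) (s A x M : R) : 0 < s -> 1 <= A ->
  2 * A <= s -> 0 < M -> M^-1 <= (s ^+ 2)^-1 -> `|x| <= A * s ->
  `|x / M| <= 1 / 2 /\ (x / M) ^+ 2 <= A ^+ 2 / s ^+ 2.
Proof.
move=> s0 A1 As MM iMs xA.
have xs : `|x / M| <= A / s.
  rewrite normrM normfV (gtr0_norm MM).
  have -> : A / s = A * s * (s ^+ 2)^-1 by field; rewrite gt_eqF.
  by apply: ler_pM; rewrite ?normr_ge0 ?invr_ge0 ?(ltW MM).
split; first by apply: (le_trans xs); rewrite ler_pdivrMr//; lra.
rewrite -real_normK ?num_real// -expr_div_n ler_pXn2r ?nnegrE//.
by rewrite divr_ge0// ltW//; lra.
Qed.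

(** The binomial probability divided by the unnormalized Gaussian density; it is
    nearly constant near the mean. *)
Definition gaussian_quotient (R : realType) (N m : nat) (p s : R) (k : nat) : R :=
  binomial_pmf N p k * expR (((k%:R - m%:R) / s) ^+ 2 / 2).

(** With u = (k - m) / (N - m) and v = (k + 1 - m) / m the ratio of consecutive
    binomial probabilities is (1 - u) / (1 + v), that is exp(- u - v) up to
    exp(O(u^2 + v^2)), while the Gaussian contributes exp(u + v + O(1 / s^2)). *)
Lemma gaussian_quotient_step (R : realType) N m (p s A : R) k :
  (0 < m < N)%N -> m%:R = p * N%:R -> 0 < s -> s ^+ 2 = N%:R * p * (1 - p) ->
  1 <= A -> 2 * A <= s ->
  `|k%:R - m%:R| <= A * s -> `|k%:R + 1 - m%:R| <= A * s ->
  gaussian_quotient N m p s k.+1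
    <= expR (5 * A ^+ 2 / s ^+ 2) * gaussian_quotient N m p s k /\
  gaussian_quotient N m p s k
    <= expR (5 * A ^+ 2 / s ^+ 2) * gaussian_quotient N m p s k.+1.
Proof.
move=> mN pN s0 sE A1 As kA k1A.
have /andP[m_gt0 /ltnW leqmN] := mN.
have isE := inv_variance mN pN sE.
have p01 := binomial_param01 mN pN.
have M0 : 0 < m%:R :> R by rewrite ltr0n.
have Q0 : 0 < (N - m)%:R :> R by rewrite ltr0n subn_gt0; case/andP: mN.
have iM : m%:R^-1 <= (s ^+ 2)^-1 by rewrite isE lerDl invr_ge0.
have iQ : (N - m)%:R^-1 <= (s ^+ 2)^-1 by rewrite isE lerDr invr_ge0.
have b0 i : 0 <= binomial_pmf N p i.
  by apply: binomial_pmf_ge0; case/andP: p01 => *; rewrite !ltW.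
have sA : A * s <= s ^+ 2 by rewrite expr2 ler_pM2r//; lra.
have kN : (k < N)%N.
  rewrite -(ltr_nat R).
  have : s ^+ 2 <= (N - m)%:R by rewrite -lef_pV2 ?posrE ?exprn_gt0.
  rewrite natrB//.
  by move: k1A; rewrite ler_norml => /andP[_]; lra.
have [u2 uu] := window_ratio_small s0 A1 As Q0 iQ kA.
have [v2 vv] := window_ratio_small s0 A1 As M0 iM k1A.
have ratio := binomial_pmf_ratio mN pN kN.
set u := _ / (N - m)%:R in u2 uu ratio; set v := _ / m%:R in v2 vv ratio.
have uvE : u + v = (k%:R - m%:R) * (s ^+ 2)^-1 + m%:R^-1.
  by rewrite isE /u /v; ring.
have A2 : 1 <= A ^+ 2 by rewrite expr_ge1//; lra.
have is0 : 0 < (s ^+ 2)^-1 by rewrite invr_gt0 exprn_gt0.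
rewrite /gaussian_quotient.
set z := (k%:R - m%:R) / s.
have -> : ((k.+1%:R - m%:R) / s) ^+ 2 / 2 = z ^+ 2 / 2 +
    ((k%:R - m%:R) * (s ^+ 2)^-1 + (s ^+ 2)^-1 / 2).
  by rewrite /z -natr1; field; rewrite gt_eqF.
have Ais : (s ^+ 2)^-1 <= A ^+ 2 / s ^+ 2 by rewrite ler_peMl// ltW.
have uE : expR (- u - 2 * u ^+ 2) <= 1 - u.
  rewrite -[u ^+ 2]sqrrN; apply: expR_sub_sqr_le.
  by move: u2; rewrite ler_norml; lra.
have vE : expR (v - 2 * v ^+ 2) <= 1 + v.
  by apply: expR_sub_sqr_le; move: v2; rewrite ler_norml; lra.
have u1 := expR_ge1Dx (- u); have v1 := expR_ge1Dx v.
split.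
  have : binomial_pmf N p k.+1
      <= binomial_pmf N p k * expR (- u - (v - 2 * v ^+ 2)).
    rewrite expRB mulrA ler_pdivlMr ?expR_gt0//.
    by apply: (le_trans (ler_wpM2l (b0 _) vE)); rewrite ratio ler_wpM2l.
  move=> /(ler_wpM2r (expR_ge0 (z ^+ 2 / 2 +
    ((k%:R - m%:R) * (s ^+ 2)^-1 + (s ^+ 2)^-1 / 2)))) /le_trans; apply.
  rewrite [leRHS]mulrCA -[leLHS]mulrA -!expRD ler_wpM2l// ler_expR.
  by lra.
have : binomial_pmf N p k
    <= binomial_pmf N p k.+1 * expR (v - (- u - 2 * u ^+ 2)).
  rewrite expRB mulrA ler_pdivlMr ?expR_gt0//.
  by apply: (le_trans (ler_wpM2l (b0 _) uE)); rewrite -ratio ler_wpM2l.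
move=> /(ler_wpM2r (expR_ge0 (z ^+ 2 / 2))) /le_trans; apply.
rewrite [leRHS]mulrCA -[leLHS]mulrA -!expRD ler_wpM2l// ler_expR.
by lra.
Qed.

(** At most 2 A s steps separate two points of the window, each costing a factor
    exp(5 A^2 / s^2). *)
Lemma gaussian_quotient_window (R : realType) N m (p s A : R) k l :
  (0 < m < N)%N -> m%:R = p * N%:R -> 0 < s -> s ^+ 2 = N%:R * p * (1 - p) ->
  1 <= A -> 2 * A <= s ->
  `|k%:R - m%:R| <= A * s -> `|l%:R - m%:R| <= A * s ->
  gaussian_quotient N m p s k
    <= expR (10 * A ^+ 3 / s) * gaussian_quotient N m p s l.
Proof.
move=> mN pN s0 sE A1 As.
pose D := gaussian_quotient N m p s.
have chain i j : `|i%:R - m%:R| <= A * s -> `|(i + j)%:R - m%:R| <= A * s ->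
    D (i + j)%N <= expR (5 * A ^+ 2 / s ^+ 2 * j%:R) * D i /\
    D i <= expR (5 * A ^+ 2 / s ^+ 2 * j%:R) * D (i + j)%N.
  move=> iA; elim: j => [|j IH] ijA; first by rewrite addn0 mulr0 expR0 mul1r.
  have ijA' : `|(i + j)%:R - m%:R| <= A * s.
    move: iA ijA; rewrite !ler_norml addnS -natr1 natrD.
    by have : 0 <= j%:R :> R by []; lra.
  have [IH1 IH2] := IH ijA'.
  have [|st1 st2] := gaussian_quotient_step mN pN s0 sE A1 As ijA'.
    by rewrite natr1 -addnS.
  rewrite -[j.+1%:R]natr1 mulrDr mulr1 expRD addnS; split.
    apply: (le_trans st1); rewrite [X in _ <= X * _]mulrC -[leRHS]mulrA.
    by rewrite ler_wpM2l ?expR_ge0.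
  by apply: (le_trans IH2); rewrite -[leRHS]mulrA ler_wpM2l ?expR_ge0.
have D0 i : 0 <= D i.
  rewrite /D/gaussian_quotient mulr_ge0 ?expR_ge0//.
  by apply: binomial_pmf_ge0; case/andP: (binomial_param01 mN pN) => *; rewrite !ltW.
have total j (x y : R) : `|x - m%:R| <= A * s -> `|y - m%:R| <= A * s ->
    x + j = y -> expR (5 * A ^+ 2 / s ^+ 2 * j) <= expR (10 * A ^+ 3 / s).
  move=> xA yA xy; rewrite ler_expR.
  have -> : 10 * A ^+ 3 / s = 5 * A ^+ 2 / s ^+ 2 * (2 * (A * s)).
    by field; rewrite gt_eqF.
  have c0 : 0 <= 5 * A ^+ 2 / s ^+ 2.
    by apply: divr_ge0; [apply: mulr_ge0 => //|]; exact: sqr_ge0.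
  rewrite ler_wpM2l//.
  by move: xA yA; rewrite !ler_norml; lra.
move=> kA lA; have [kl|/ltnW lk] := leqP k l.
  have [|_ H] := chain k (l - k)%N kA; first by rewrite subnKC.
  apply: (le_trans H); rewrite subnKC// ler_wpM2r ?D0//.
  by apply: (total _ _ _ kA lA); rewrite -natrD subnKC.
have [|H _] := chain l (k - l)%N lA; first by rewrite subnKC.
move: H; rewrite subnKC// => /le_trans; apply; rewrite ler_wpM2r ?D0//.
by apply: (total _ _ _ lA kA); rewrite -natrD subnKC.
Qed.

(** The Gaussian mass of the cell of length 1 / s that belongs to k. *)
Definition cell_mass (R : realType) (m : nat) (s : R) (k : nat) : R :=
  std_cdf ((k.+1%:R - m%:R) / s) - std_cdf ((k%:R - m%:R) / s).

(** The first-order approximation of cell_mass. *)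
Definition cell_height (R : realType) (m : nat) (s : R) (k : nat) : R :=
  normal_peak 1 / s * expR (- ((k%:R - m%:R) / s) ^+ 2 / 2).

Lemma cell_mass_bounds (R : realType) m (s A : R) k :
  0 < s -> 1 <= A -> 2 * A <= s -> `|k%:R - m%:R| <= A * s ->
  cell_height m s k * expR (- (2 * A / s)) <= cell_mass m s k
    <= cell_height m s k * expR (2 * A / s).
Proof.
move=> s0 A1 As kA; rewrite /cell_mass /cell_height.
have -> : (k.+1%:R - m%:R) / s = (k%:R - m%:R) / s + s^-1.
  by rewrite -natr1; field; rewrite gt_eqF.
have : `|(k%:R - m%:R) / s| <= A.
  by rewrite normrM normfV (gtr0_norm s0) ler_pdivrMr.
move: ((k%:R - m%:R) / s) => z zA {kA}.
have is0 : 0 < s^-1 by rewrite invr_gt0.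
have is1 : s^-1 <= 1 by rewrite invf_le1//; lra.
have zz : z <= z + s^-1 by rewrite lerDl ltW.
have pdf t : z <= t <= z + s^-1 ->
    normal_peak 1 * expR (- z ^+ 2 / 2) * expR (- (2 * A / s)) <= normal_pdf 0 1 t
    <= normal_peak 1 * expR (- z ^+ 2 / 2) * expR (2 * A / s).
  move=> /andP[zt tz]; rewrite std_pdfE -!mulrA.
  apply/andP; split; apply: ler_wpM2l; rewrite ?normal_peak_ge0//.
    have [r [r0 r1 tE]] : exists r, [/\ 0 <= r, r <= s^-1 & t = z + r].
      by exists (t - z); split; lra.
    rewrite -expRD ler_expR; move: zA; rewrite ler_norml => /andP[z1 z2].
    have h1 : 0 <= r * (A - z) by rewrite mulr_ge0//; lra.
    have h2 : 0 <= r * (1 - r) by rewrite mulr_ge0//; lra.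
    have h3 : 0 <= (s^-1 - r) * A by rewrite mulr_ge0//; lra.
    have h4 : r <= r * A by rewrite ler_peMr.
    by rewrite tE; lra.
  have [r [r0 r1 tE]] : exists r, [/\ 0 <= r, r <= s^-1 & t = z + r].
    by exists (t - z); split; lra.
  rewrite -expRD ler_expR; move: zA; rewrite ler_norml => /andP[z1 z2].
  have h1 : 0 <= r * (A + z) by rewrite mulr_ge0//; lra.
  have h3 : 0 <= (s^-1 - r) * A by rewrite mulr_ge0//; lra.
  have h5 : 0 <= r ^+ 2 by exact: sqr_ge0.
  have h6 : 0 <= r * A by rewrite mulr_ge0//; lra.
  by rewrite tE; lra.
have pos : 0 <= normal_peak 1 * expR (- z ^+ 2 / 2) * expR (- (2 * A / s)).
  by rewrite !mulr_ge0 ?normal_peak_ge0 ?expR_ge0.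
have := std_cdf_itv zz pos pdf.
by rewrite (_ : z + s^-1 - z = s^-1) 1?addrC ?addKr// !(mulrAC _ _ s^-1).
Qed.

(** The binomial probabilities are proportional to the Gaussian masses up to a
    factor tending to 1; stated as a symmetric product so that the constant of
    proportionality does not appear. *)
Lemma pmf_cell_mass_swap (R : realType) N m (p s A : R) k l :
  (0 < m < N)%N -> m%:R = p * N%:R -> 0 < s -> s ^+ 2 = N%:R * p * (1 - p) ->
  1 <= A -> 2 * A <= s ->
  `|k%:R - m%:R| <= A * s -> `|l%:R - m%:R| <= A * s ->
  binomial_pmf N p k * cell_mass m s l
    <= expR (14 * A ^+ 3 / s) * (binomial_pmf N p l * cell_mass m s k).
Proof.
move=> mN pN s0 sE A1 As kA lA.
have quot := gaussian_quotient_window mN pN s0 sE A1 As kA lA.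
have /andP[_ cl] := cell_mass_bounds s0 A1 As lA.
have /andP[ck _] := cell_mass_bounds s0 A1 As kA.
have b0 i : 0 <= binomial_pmf N p i.
  apply: binomial_pmf_ge0; case/andP: (binomial_param01 mN pN) => *.
  by rewrite !ltW.
have bE i : binomial_pmf N p i
    = gaussian_quotient N m p s i * expR (- ((i%:R - m%:R) / s) ^+ 2 / 2).
  by rewrite /gaussian_quotient -mulrA -expRD mulNr subrr expR0 mulr1.
have b0k := b0 k; have b0l := b0 l.
apply: (le_trans (ler_wpM2l b0k cl)).
set el := expR (- ((l%:R - m%:R) / s) ^+ 2 / 2) in bE.
set ek := expR (- ((k%:R - m%:R) / s) ^+ 2 / 2) in bE.
have el0 : 0 <= el by exact: expR_ge0.
have ek0 : 0 <= ek by exact: expR_ge0.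
have c0 : 0 <= normal_peak (1 : R) / s.
  by rewrite divr_ge0 ?normal_peak_ge0 ?ltW.
apply: (@le_trans _ _ (expR (10 * A ^+ 3 / s) * gaussian_quotient N m p s l *
    (ek * (normal_peak 1 / s) * el * expR (2 * A / s)))).
  rewrite bE /cell_height -/ek -/el.
  rewrite [leLHS](_ : _ = gaussian_quotient N m p s k *
    (ek * (normal_peak 1 / s) * el * expR (2 * A / s))); last by ring.
  by rewrite ler_wpM2r// mulr_ge0 ?expR_ge0// mulr_ge0// mulr_ge0.
apply: (@le_trans _ _ (expR (10 * A ^+ 3 / s + 4 * A / s) *
    (binomial_pmf N p l * (cell_height m s k * expR (- (2 * A / s)))))).
  rewrite [binomial_pmf N p l]bE /cell_height -/ek -/el.
  have -> : 10 * A ^+ 3 / s + 4 * A / s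
      = 10 * A ^+ 3 / s + (2 * A / s + 2 * A / s) by ring.
  rewrite 2!expRD expRN le_eqVlt; apply/orP; left; apply/eqP.
  by field; rewrite ?(gt_eqF s0) ?(gt_eqF (expR_gt0 _)).
have A3 : A <= A ^+ 3 by rewrite exprS ler_peMr ?expr_ge1//; lra.
apply: ler_pM; rewrite ?expR_ge0//.
- by rewrite mulr_ge0// mulr_ge0 ?expR_ge0// /cell_height mulr_ge0 ?expR_ge0.
- rewrite ler_expR -mulrDl ler_pM2r ?invr_gt0//; lra.
- by rewrite ler_wpM2l.
Qed.

Lemma sum_swap_le (R : realFieldType) (f g : nat -> R) (E : R) a b c d :
  (forall k l, (a <= k < b)%N -> (c <= l < d)%N -> f k * g l <= E * (f l * g k)) ->
  (\sum_(a <= k < b) f k) * (\sum_(c <= l < d) g l)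
    <= E * ((\sum_(c <= l < d) f l) * (\sum_(a <= k < b) g k)).
Proof.
move=> fg; rewrite [X in E * X]mulrC !big_distrlr/= mulr_sumr.
rewrite big_nat [leRHS]big_nat; apply: ler_sum => k kab.
rewrite mulr_sumr big_nat [leRHS]big_nat; apply: ler_sum => l lcd.
by rewrite [X in E * X]mulrC fg.
Qed.

Lemma nat_above (R : realType) (y : R) : 0 <= y ->
  {a : nat | [/\ y < a%:R, a%:R <= y + 1 & forall k, (k < a)%N = (k%:R <= y)]}.
Proof.
move=> y0; exists (Num.truncn y).+1.
have /andP[ty yt] := truncn_itv y0.
split => [//||k]; first by rewrite -natr1 lerD2r.
rewrite ltnS; apply/idP/idP => [kt|ky]; first by rewrite (le_trans _ ty)// ler_nat.
by rewrite -ltnS -(ltr_nat R) (le_lt_trans ky).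
Qed.

Lemma binomial_tail_window (R : realType) N m (p s A : R) a d :
  (0 < m < N)%N -> m%:R = p * N%:R -> 0 < s -> s ^+ 2 = N%:R * p * (1 - p) ->
  0 < A -> (a <= d <= N.+1)%N ->
  (forall k, (k < a)%N -> k%:R <= m%:R - A * s) ->
  (forall k, (d <= k)%N -> m%:R + A * s <= k%:R) ->
  \sum_(0 <= k < a) binomial_pmf N p k + \sum_(d <= k < N.+1) binomial_pmf N p k
    <= 1 / A ^+ 2.
Proof.
move=> mN pN s0 sE A0 /andP[ad dN] aP dP.
have As0 : 0 < A * s by rewrite mulr_gt0.
have p01 : 0 <= p <= 1 by case/andP: (binomial_param01 mN pN) => *; rewrite !ltW.
have := @binomial_tail R N p (A * s) p01 As0.
rewrite -sE (_ : s ^+ 2 / (A * s) ^+ 2 = 1 / A ^+ 2) => [|]; last first.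
  by field; rewrite (gt_eqF s0) (gt_eqF A0).
apply: le_trans; set f := binomial_pmf N p.
have f0 k : 0 <= f k by exact: binomial_pmf_ge0.
rewrite -(big_mkord (fun k => A * s <= `|k%:R - N%:R * p|) f).
rewrite [leRHS](@big_cat_nat _ _ _ d _ N.+1)//=.
rewrite [X in _ <= X + _](@big_cat_nat _ _ _ a _ d)//=.
have mid0 : 0 <= \sum_(a <= k < d | A * s <= `|k%:R - N%:R * p|) f k.
  exact: sumr_ge0.
have E0 : \sum_(0 <= k < a) f k
    = \sum_(0 <= k < a | A * s <= `|k%:R - N%:R * p|) f k.
  rewrite big_nat_cond [RHS]big_nat_cond; apply: eq_bigl => k /=.
  case ka : (k < a)%N => //=; have := aP k ka => {mid0} ka'.
  by rewrite [N%:R * p]mulrC -pN ler_normr; apply/esym/orP; right; lra.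
have E1 : \sum_(d <= k < N.+1) f k
    = \sum_(d <= k < N.+1 | A * s <= `|k%:R - N%:R * p|) f k.
  rewrite big_nat_cond [RHS]big_nat_cond; apply: eq_bigl => k /=.
  case dk : (d <= k)%N => //=; have := dP k dk => {mid0 E0} dk'.
  case: (k < N.+1)%N => //=.
  by rewrite [N%:R * p]mulrC -pN ler_normr; apply/esym/orP; left; lra.
by rewrite -E0 -E1 lerD2r lerDl.
Qed.

(** S and GI are the binomial and Gaussian masses of a part of a window, W and GW
    those of the window.  If the quotients S / W and GI / GW agree up to a
    factor 1 + 2 eta and the window carries almost all of both masses, then S is
    close to the mass P that GI approximates. *)
Lemma mass_comparison (R : realFieldType) (eta P S W GI GW : R) :
  0 < eta -> 8 * eta <= 1 -> 0 <= P <= 1 -> 0 <= S <= W -> 1 - eta <= W <= 1 ->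
  1 - 3 * eta <= GW <= 1 -> P - 2 * eta <= GI <= P + eta ->
  S * GW <= (1 + 2 * eta) * (W * GI) -> W * GI <= (1 + 2 * eta) * (S * GW) ->
  P - 5 * eta <= S <= P + 7 * eta.
Proof.
move=> e0 e1 /andP[P0 P1] /andP[S0 SW] /andP[W1 W2] /andP[GW1 GW2].
move=> /andP[GI1 GI2] H1 H2.
have k1 : eta * P <= eta by rewrite ler_piMr// ltW.
have k2 : eta * eta <= eta / 8 by rewrite ler_wpM2l ?(ltW e0)//; lra.
have k3 : eta * S <= eta by rewrite ler_piMr ?(ltW e0)//; lra.
have k4 : eta * W <= eta by rewrite ler_piMr ?(ltW e0)//; lra.
have W0 : 0 <= W by lra.
have c0 : 0 <= 1 + 2 * eta by lra.
apply/andP; split.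
  have h1 := ler_wpM2l W0 GI1.
  have h2 := ler_wpM2l S0 GW2.
  have h3 := ler_wpM2l c0 h2.
  have h4 := ler_wpM2r P0 W1.
  by lra.
have h1 := ler_wpM2l S0 GW1.
have h2 := ler_wpM2l W0 GI2.
have Pe : 0 <= P + eta by lra.
have h3 := ler_wpM2r Pe W2.
have h4 := ler_wpM2l c0 (le_trans h2 h3).
by lra.
Qed.

(** Uniform in N, m and p: only the size of the standard deviation s matters.  The
    mean p N is assumed to be an integer m. *)
Lemma binomial_clt (R : realType) (x e : R) : 0 < e ->
  exists s0 : R, forall N m (p s : R), (0 < m < N)%N -> m%:R = p * N%:R ->
    s0 <= s -> 0 < s -> s ^+ 2 = N%:R * p * (1 - p) ->
    `|\sum_(k < N.+1 | k%:R <= m%:R + x * s) binomial_pmf N p k - std_cdf x|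
      <= e.
Proof.
(* The errors in mass_comparison and the tails add up to at most 8 eta. *)
move=> e0; pose eta := Num.min e 1 / 8.
have eta0 : 0 < eta by rewrite divr_gt0// lt_min e0 ltr01.
have [etae eta1] : 8 * eta <= e /\ 8 * eta <= 1.
  by rewrite /eta mulrC divfK//; split; rewrite ge_min lexx ?orbT.
have [A0 tails] := @std_cdf_tails R eta eta0.
pose A := Num.max (Num.max 1 A0) (Num.max (`|x| + 1) eta^-1).
have [A1 [AA0 [xA etaA]]] :
    1 <= A /\ A0 <= A /\ `|x| + 1 <= A /\ eta^-1 <= A.
  by rewrite /A !le_max !lexx /= !orbT.
have {tails} [tail0 tail1] := tails A AA0.
exists (Num.max (2 * A) (Num.max eta^-1 (14 * A ^+ 3 / eta))) => N m p s mN pN.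
rewrite !ge_max => /and3P[As etas rhos] s0 sE.
have /andP[m_gt0 /ltnW leqmN] := mN.
have /andP[p0 p1] := binomial_param01 mN pN.
have isE := inv_variance mN pN sE.
have M0 : 0 < m%:R :> R by rewrite ltr0n.
have Q0 : 0 < (N - m)%:R :> R by rewrite ltr0n subn_gt0; case/andP: mN.
have iM : m%:R^-1 <= (s ^+ 2)^-1 by rewrite isE lerDl invr_ge0.
have iQ : (N - m)%:R^-1 <= (s ^+ 2)^-1 by rewrite isE lerDr invr_ge0.
have s2 : 0 < s ^+ 2 by rewrite exprn_gt0.
have sM : s ^+ 2 <= m%:R by rewrite -lef_pV2 ?posrE.
have sQ : s ^+ 2 <= N%:R - m%:R.
  by rewrite -natrB// -lef_pV2 ?posrE.
have sA : A * s <= s ^+ 2 by rewrite expr2 ler_pM2r//; lra.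
have xs : `|x * s| <= A * s by rewrite normrM (gtr0_norm s0) ler_pM2r//; lra.
move: xs; rewrite ler_norml => /andP[xs1 xs2].
(* The window is a <= k < d, and the part of it below the threshold is
   a <= k < c. *)
have [a [a1 a2 aE]] : {a : nat | [/\ m%:R - A * s < a%:R,
    a%:R <= m%:R - A * s + 1 & forall k, (k < a)%N = (k%:R <= m%:R - A * s)]}.
  by apply: nat_above; lra.
have [c [c1 c2 cE]] : {a : nat | [/\ m%:R + x * s < a%:R,
    a%:R <= m%:R + x * s + 1 & forall k, (k < a)%N = (k%:R <= m%:R + x * s)]}.
  by apply: nat_above; lra.
have [d [d1 d2 dE]] : {a : nat | [/\ m%:R + A * s < a%:R,
    a%:R <= m%:R + A * s + 1 & forall k, (k < a)%N = (k%:R <= m%:R + A * s)]}.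
  by apply: nat_above; lra.
have ac : (a <= c)%N by rewrite leqNgt aE -ltNge; lra.
have cd : (c <= d)%N by rewrite leqNgt cE -ltNge; lra.
have dN : (d <= N.+1)%N by rewrite -(ler_nat R) -[N.+1%:R]natr1; lra.
have ad := leq_trans ac cd; have cN := leq_trans cd dN.
have aN := leq_trans ad dN.
pose f := binomial_pmf N p; pose g := cell_mass (R := R) m s.
have f0 k : 0 <= f k by apply: binomial_pmf_ge0; rewrite !ltW.
have win k : (a <= k < d)%N -> `|k%:R - m%:R| <= A * s.
  rewrite leqNgt aE dE -ltNge => /andP[ka kd]; rewrite ler_norml; lra.
pose S0 := \sum_(0 <= k < a) f k; pose SI := \sum_(a <= k < c) f k.
pose SJ := \sum_(c <= k < d) f k; pose S1 := \sum_(d <= k < N.+1) f k.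
have S0_ge0 : 0 <= S0 by apply: sumr_ge0.
have SI_ge0 : 0 <= SI by apply: sumr_ge0.
have SJ_ge0 : 0 <= SJ by apply: sumr_ge0.
have S1_ge0 : 0 <= S1 by apply: sumr_ge0.
have total : S0 + SI + SJ + S1 = 1.
  rewrite -(sum_binomial_pmf N p) -(big_mkord xpredT f).
  rewrite (@big_cat_nat _ _ _ a _ N.+1)//=.
  rewrite (@big_cat_nat _ _ _ c a N.+1)//=.
  by rewrite (@big_cat_nat _ _ _ d c N.+1)//= !addrA.
have tail : S0 + S1 <= eta.
  have invA : 1 / A ^+ 2 <= eta.
    have A0' : 0 < A by exact: lt_le_trans ltr01 A1.
    rewrite ler_pdivrMr ?exprn_gt0// -ler_pdivrMl// mulr1 (le_trans etaA)//.
    by rewrite expr2 ler_peMr// ltW.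
  apply: le_trans invA; apply: (binomial_tail_window mN pN s0 sE) => //.
  - exact: lt_le_trans ltr01 A1.
  - by rewrite ad.
  - by move=> k; rewrite aE.
  - by move=> k; rewrite leqNgt dE -ltNge => /ltW.
pose GI := std_cdf ((c%:R - m%:R) / s) - std_cdf ((a%:R - m%:R) / s).
pose GW := std_cdf ((d%:R - m%:R) / s) - std_cdf ((a%:R - m%:R) / s).
have GIE : \sum_(a <= k < c) g k = GI.
  exact: (telescope_sumr (fun k => std_cdf ((k%:R - m%:R) / s))).
have GWE : \sum_(a <= k < d) g k = GW.
  by rewrite /g (telescope_sumr (fun k => std_cdf ((k%:R - m%:R) / s))).
have SW : \sum_(a <= k < d) f k = SI + SJ.
  by rewrite (@big_cat_nat _ _ _ c).
have is1 : s^-1 <= eta by rewrite -[eta]invrK lef_pV2 ?posrE ?invr_gt0.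
have [ex1 ex2] : 1 <= expR (14 * A ^+ 3 / s) /\ expR (14 * A ^+ 3 / s) <= 1 + 2 * eta.
  have r0 : 0 <= 14 * A ^+ 3 / s.
    by rewrite divr_ge0 ?(ltW s0)// mulr_ge0// exprn_ge0// (le_trans ler01).
  have r1 : 14 * A ^+ 3 / s <= eta.
    by rewrite ler_pdivrMr//; move: rhos; rewrite ler_pdivrMr// [s * eta]mulrC.
  split; first by rewrite -[leLHS]expR0 ler_expR.
  have r2 : 14 * A ^+ 3 / s <= 1 / 2 by lra.
  by apply: (le_trans (expR_le1D2 r0 r2)); rewrite lerD2l ler_wpM2l.
have H1 : SI * GW <= (1 + 2 * eta) * ((SI + SJ) * GI).
  rewrite -GWE -GIE -SW; apply: le_trans (ler_wpM2r _ ex2); last first.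
    rewrite mulr_ge0 ?sumr_ge0// => k _.
    by rewrite subr_ge0 std_cdf_nondecreasing// ler_pM2r ?invr_gt0// lerD2r ler_nat.
  apply: sum_swap_le => k l /andP[ak kc] ald.
  by apply: pmf_cell_mass_swap => //; apply: win; rewrite // ak (leq_trans kc).
have H2 : (SI + SJ) * GI <= (1 + 2 * eta) * (SI * GW).
  rewrite -GWE -GIE -SW; apply: le_trans (ler_wpM2r _ ex2); last first.
    rewrite mulr_ge0 ?sumr_ge0// => k _.
    by rewrite subr_ge0 std_cdf_nondecreasing// ler_pM2r ?invr_gt0// lerD2r ler_nat.
  apply: sum_swap_le => k l akd /andP[al lc].
  by apply: pmf_cell_mass_swap => //; apply: win; rewrite // al (leq_trans lc).
have s_neq0 : s != 0 by rewrite gt_eqF.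
have zc1 : x <= (c%:R - m%:R) / s by rewrite ler_pdivlMr// lerBrDl ltW.
have zc2 : (c%:R - m%:R) / s <= x + s^-1.
  by rewrite ler_pdivrMr// mulrDl mulVf// lerBlDl addrA.
have za2 : (a%:R - m%:R) / s <= - A + s^-1.
  by rewrite ler_pdivrMr// mulrDl mulVf// mulNr lerBlDl addrA.
have zd1 : A <= (d%:R - m%:R) / s by rewrite ler_pdivlMr// lerBrDl ltW.
have P1 := std_cdf_nondecreasing zc1.
have P2 := std_cdf_nondecreasing zc2.
have i0 : 0 <= s^-1 by rewrite invr_ge0 ltW.
have P3 := std_cdf_shift x i0.
have P4 := std_cdf_nondecreasing za2.
have P5 := std_cdf_shift (- A) i0.
have P6 := std_cdf_nondecreasing zd1.
have P7 := std_cdf_ge0 ((a%:R - m%:R) / s).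
have P8 := std_cdf_le1 ((d%:R - m%:R) / s).
have P9 := std_cdf_le1 x. have P10 := std_cdf_ge0 x.
have cumE : \sum_(k < N.+1 | k%:R <= m%:R + x * s) f k = S0 + SI.
  rewrite -(big_mkord (fun k => k%:R <= m%:R + x * s) f).
  rewrite (@big_cat_nat _ _ _ c _ N.+1)//=.
  rewrite [X in _ + X]big_nat_cond [X in _ + X]big1 ?addr0; last first.
    by move=> k /andP[/andP[ck _]]; rewrite -cE ltnNge ck.
  rewrite -(@big_cat_nat _ _ _ a _ c)//= big_nat_cond [RHS]big_nat_cond.
  by apply: eq_bigl => k; rewrite -cE/=; case: (k < c)%N.
rewrite {}cumE ler_norml.
have GW1 : 1 - 3 * eta <= GW.
  by rewrite /GW; clear -P4 P5 P6 is1 tail0 tail1; lra.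
have GW2 : GW <= 1 by rewrite /GW; clear -P7 P8; lra.
have GI1 : std_cdf x - 2 * eta <= GI.
  by rewrite /GI; clear -P1 P4 P5 is1 tail0; lra.
have GI2 : GI <= std_cdf x + eta.
  by rewrite /GI; clear -P2 P3 P7 is1; lra.
have SIJ1 : SI + SJ <= 1 by clear -total S0_ge0 S1_ge0; lra.
have SIJ2 : 1 - eta <= SI + SJ by clear -total tail; lra.
have P01 : 0 <= std_cdf x <= 1 by rewrite P10.
have SW' : 0 <= SI <= SI + SJ by rewrite SI_ge0 lerDl.
have W' : 1 - eta <= SI + SJ <= 1 by rewrite SIJ2.
have GW' : 1 - 3 * eta <= GW <= 1 by rewrite GW1.
have GI' : std_cdf x - 2 * eta <= GI <= std_cdf x + eta by rewrite GI1.
have /andP[low up] := mass_comparison eta0 eta1 P01 SW' W' GW' GI' H1 H2.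
by clear -low up tail S0_ge0 S1_ge0 etae eta0; apply/andP; split; lra.
Qed.

(** * The two random graph models *)

Lemma card_graph_size n k : #|[pred G : graph n | #|G| == k]| = 'C('C(n, 2), k).
Proof. by rewrite -(card_edge n) -card_draws; apply: eq_card => G; rewrite !inE. Qed.

Lemma card_graph_le n (G : graph n) : (#|G| <= 'C(n, 2))%N.
Proof. by rewrite -card_edge max_card. Qed.

Lemma gnm_ge0 (R : realType) n k (A : pred (graph n)) : 0 <= gnm R k A.
Proof. by rewrite /gnm divr_ge0. Qed.

Lemma gnm_le1 (R : realType) n k (A : pred (graph n)) : gnm R k A <= 1.
Proof.
rewrite /gnm; have [->|c0] := eqVneq #|[pred G : graph n | #|G| == k]| 0%N.
  by rewrite invr0 mulr0.
rewrite ler_pdivrMr ?ltr0n ?lt0n// mul1r ler_nat.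
by apply/subset_leq_card/fintype.subsetP => G; rewrite !inE => /andP[].
Qed.

Lemma gnm_le_gnm (R : realType) n k (A B : pred (graph n)) :
  (forall G : graph n, #|G| = k -> A G -> B G) -> gnm R k A <= gnm R k B.
Proof.
move=> AB; rewrite /gnm ler_wpM2r ?invr_ge0// ler_nat.
apply/subset_leq_card/fintype.subsetP => G; rewrite !inE => /andP[/eqP Gk AG].
by rewrite Gk eqxx AB.
Qed.

(** Given its number of edges, the binomial random graph is uniform. *)
Lemma gnp_gnm (R : realType) n (p : R) (A : pred (graph n)) :
  gnp p A = \sum_(k < ('C(n, 2)).+1) binomial_pmf 'C(n, 2) p k * gnm R k A.
Proof.
have ltk (G : graph n) : (#|G| < ('C(n, 2)).+1)%N by rewrite ltnS card_graph_le.
rewrite /gnp (partition_big (fun G => Ordinal (ltk G)) xpredT)//=.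
apply: eq_bigr => k _; rewrite binomial_pmfE /gnm card_graph_size.
have C0 : 'C('C(n, 2), k)%:R != 0 :> R.
  by rewrite pnatr_eq0 -lt0n bin_gt0 -ltnS.
rewrite (eq_bigr (fun=> p ^+ k * (1 - p) ^+ ('C(n, 2) - k))); last first.
  by move=> G /andP[_ /eqP <-].
rewrite sumr_const (_ : #|_| = #|[pred G : graph n | (#|G| == k) && A G]|).
  by rewrite -[LHS]mulr_natl; field.
by apply: eq_card => G; rewrite !inE andbC.
Qed.

Lemma gnp_predC (R : realType) n (p : R) (A : pred (graph n)) :
  gnp p (predC A) = 1 - gnp p A.
Proof.
rewrite !gnp_gnm -(sum_binomial_pmf 'C(n, 2) p) -sumrB; apply: eq_bigr => k _.
rewrite -[X in X - _]mulr1 -mulrBr; congr (_ * _); apply/eqP.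
rewrite eq_sym subr_eq /gnm -mulrDl -natrD addnC card_graph_size.
have C0 : 'C('C(n, 2), k)%:R != 0 :> R.
  by rewrite pnatr_eq0 -lt0n bin_gt0 -ltnS.
rewrite -[X in X == _](divff C0) -card_graph_size.
rewrite -(cardID A [pred G : graph n | #|G| == k]).
by apply/eqP; congr ((_ + _)%:R / _); apply: eq_card => G; rewrite !inE// andbC.
Qed.

(** Transfers the comparison of an event A with a condition D on the number of
    edges: outside an exceptional set of sizes, where W fails, and an
    exceptional event B that is rare for each good size, A forces D. *)
Lemma gnp_le (R : realType) n (p d : R) (A B : pred (graph n)) (D W : pred nat) :
  0 <= p <= 1 ->
  (forall k, (k <= 'C(n, 2))%N -> W k -> gnm R k B <= d) -> 0 <= d ->
  (forall G : graph n, W #|G| -> ~~ B G -> A G -> D #|G|) ->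
  gnp p A <= \sum_(k < ('C(n, 2)).+1 | D k) binomial_pmf 'C(n, 2) p k
    + \sum_(k < ('C(n, 2)).+1 | ~~ W k) binomial_pmf 'C(n, 2) p k + d.
Proof.
move=> p01 WB d0 AD; rewrite gnp_gnm.
have f0 k : 0 <= binomial_pmf 'C(n, 2) p k by exact: binomial_pmf_ge0.
rewrite -[X in _ + X](mul1r d) -[X in _ <= _ + X * _](sum_binomial_pmf 'C(n, 2) p).
rewrite mulr_suml big_mkcond [X in _ <= _ + X + _]big_mkcond.
rewrite [X in _ <= X + _ + _]big_mkcond/= -!big_split/=.
apply: ler_sum => k _; rewrite /=.
have kN : (k <= 'C(n, 2))%N by rewrite -ltnS.
have fk := f0 k; have fd : 0 <= binomial_pmf 'C(n, 2) p k * d by rewrite mulr_ge0.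
have A1 : binomial_pmf 'C(n, 2) p k * gnm R k A <= binomial_pmf 'C(n, 2) p k.
  by rewrite ler_piMr ?gnm_le1.
case: ifPn => Dk.
  by apply: (le_trans A1); case: ifPn => _; rewrite ?addr0 -?addrA lerDl ?addr_ge0.
case: ifPn => Wk; first by rewrite add0r (le_trans A1)// lerDl.
rewrite !add0r ler_wpM2l//; apply: le_trans (WB k kN (negPn Wk)).
apply: gnm_le_gnm => G Gk AG; apply: contraNT Dk => BG.
by rewrite -Gk; apply: AD; rewrite ?Gk//; exact: negPn.
Qed.

(** * The ratio of the two means *)

(** The mean of the count in G(n,k) divided by its mean in G(n,p), where
    p = m / N. *)
Definition mean_ratio (R : realType) (N m h k : nat) : R :=
  \prod_(i < h) ((k%:R - i%:R) / (m%:R - m%:R / N%:R * i%:R)).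

Lemma bin_ratio_prod (R : realType) N h k : (h <= k <= N)%N ->
  'C(N - h, k - h)%:R / 'C(N, k)%:R
    = \prod_(i < h) ((k%:R - i%:R) / (N%:R - i%:R)) :> R.
Proof.
elim: h => [|h IH] /andP[hk kN].
  rewrite big_ord0 !subn0 divff// pnatr_eq0 -lt0n bin_gt0//.
have hN : (h < N)%N := leq_trans hk kN.
rewrite big_ord_recr/= -IH ?(ltnW hk)//.
have Nh : N%:R - h%:R != 0 :> R by rewrite -natrB ?(ltnW hN)// pnatr_eq0 -lt0n subn_gt0.
have C0 : 'C(N, k)%:R != 0 :> R by rewrite pnatr_eq0 -lt0n bin_gt0.
have E : (N%:R - h%:R) * 'C(N - h.+1, k - h.+1)%:R
    = (k%:R - h%:R) * 'C(N - h, k - h)%:R :> R.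
  rewrite -!natrB ?(ltnW hN) ?(ltnW hk)// -!natrM; congr _%:R.
  by rewrite (subnSK hN) || (rewrite -(subnSK hN) -(subnSK hk) mul_bin_diag).
apply: (mulIf C0); rewrite divfK//; apply: (mulfI Nh); rewrite E.
by field; rewrite Nh C0.
Qed.

Lemma mean_ratioE (R : realType) N m h k (p : R) : (0 < m < N)%N ->
  m%:R = p * N%:R -> (h <= k <= N)%N ->
  'C(N - h, k - h)%:R / 'C(N, k)%:R / p ^+ h = mean_ratio R N m h k.
Proof.
move=> mN pN hkN; have /andP[p0 _] := binomial_param01 mN pN.
have N0 : N%:R != 0 :> R.
  by rewrite pnatr_eq0 -lt0n; case/andP: mN => _; exact: leq_ltn_trans.
rewrite bin_ratio_prod// -[h in p ^+ h]card_ord -prodr_const -prodf_div.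
apply: eq_bigr => i _; rewrite pN mulfK// -mulrBr.
have iN : N%:R - i%:R != 0 :> R.
  have iN : (i < N)%N by case/andP: hkN => *; apply: leq_trans (ltn_ord i) _; lia.
  by rewrite -natrB ?(ltnW iN)// pnatr_eq0 -lt0n subn_gt0.
by field; rewrite iN gt_eqF.
Qed.

Lemma prod1D_exp (R : realType) h (u : nat -> R) :
  (forall i, (i < h)%N -> `|u i| <= 1 / 2) ->
  expR (\sum_(i < h) (u i - 2 * u i ^+ 2)) <= \prod_(i < h) (1 + u i)
    <= expR (\sum_(i < h) u i).
Proof.
elim: h => [|h IH] uh; first by rewrite !big_ord0 expR0 !lexx.
have /andP[IH1 IH2] := IH (fun i ih => uh i (ltnW ih)).
have := uh h (ltnSn h); rewrite ler_norml => /andP[u1 u2].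
rewrite !big_ord_recr/=; apply/andP; split; rewrite expRD.
  by apply: ler_pM => //; rewrite ?expR_ge0//; apply: expR_sub_sqr_le; lra.
apply: ler_pM => //; last exact: expR_ge1Dx.
  by rewrite (le_trans _ IH1)// expR_ge0.
by lra.
Qed.

Lemma sum_affine (R : realType) h (d q : R) :
  \sum_(i < h) (d - q * i%:R) = h%:R * d - q * h%:R * (h%:R - 1) / 2.
Proof.
elim: h => [|h IH]; first by rewrite big_ord0; ring.
by rewrite big_ord_recr/= IH -natr1; field.
Qed.

Lemma error_terms_le (R : realType) (h M s A : R) :
  0 <= h -> 0 < M -> 0 < s -> s ^+ 2 <= M -> 1 <= A ->
  h * (2 * (A * s + h) * h / M ^+ 2) + h * (2 * (2 * (A * s + h) / M) ^+ 2)
    + h / (2 * M)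
  <= (18 * h ^+ 3 / M ^+ 2 + 17 * A ^+ 2 * h / M) * (1 + h * s / M).
Proof.
move=> h0 M0 s0 sM A1.
have i0 : 0 < M^-1 by rewrite invr_gt0.
have A0 : 0 <= A by rewrite (le_trans ler01).
have AA : A <= A ^+ 2 by rewrite expr2 ler_peMl.
have sMi : s ^+ 2 * M^-1 <= 1 by rewrite ler_pdivrMr// mul1r.
have hi : 0 <= h * M^-1 by rewrite mulr_ge0// ltW.
have b0 : 0 <= h * s * M^-1 by rewrite mulr_ge0 ?(ltW i0)// mulr_ge0// ltW.
have h3 : 0 <= h ^+ 3 * M^-1 ^+ 2 by rewrite mulr_ge0 ?exprn_ge0// ltW.
rewrite -exprVn.
have e1 : h * (2 * (A * s + h) * h * M^-1 ^+ 2)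
    = 2 * A * (h * M^-1) * (h * s * M^-1) + 2 * (h ^+ 3 * M^-1 ^+ 2) by ring.
have e2 : h * (2 * (2 * (A * s + h) * M^-1) ^+ 2)
    <= 16 * A ^+ 2 * (h * M^-1) + 16 * (h ^+ 3 * M^-1 ^+ 2).
  have : (A * s + h) ^+ 2 <= 2 * (A ^+ 2 * s ^+ 2) + 2 * h ^+ 2.
    by have := sqr_ge0 (A * s - h); lra.
  have c0 : 0 <= 8 * h * M^-1 ^+ 2 by rewrite !mulr_ge0 ?exprn_ge0// ltW.
  move=> /(ler_wpM2l c0) H.
  have c1 : 0 <= 16 * A ^+ 2 * (h * M^-1) by rewrite mulr_ge0// mulr_ge0 ?sqr_ge0.
  have := ler_wpM2l c1 sMi; lra.
have e3 : h / (2 * M) <= A ^+ 2 * (h * M^-1).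
  rewrite invfM mulrCA mulrC [leLHS]mulrC ler_wpM2r// ?(le_trans _ AA)//; lra.
have e4 : 2 * A * (h * M^-1) * (h * s * M^-1)
    <= 17 * A ^+ 2 * (h * M^-1) * (h * s * M^-1).
  by rewrite !ler_wpM2r//; lra.
have e5 : 0 <= 18 * (h ^+ 3 * M^-1 ^+ 2) * (h * s * M^-1).
  by rewrite mulr_ge0// mulr_ge0.
rewrite {}e1; clear -e2 e3 e4 e5.
by lra.
Qed.

(** Each factor of the product is 1 + u i with u i = (d - q i) / (m - p i) and
    d = k - m.  Replacing its denominator by m gives the main term L; the three
    errors are this replacement, the quadratic terms of the logarithms, and
    h (h - 1) versus h^2 in the sum of the q i. *)
Lemma mean_ratio_error (R : realType) (m h N k : nat) (s A : R) :
  let q := 1 - m%:R / N%:R in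
  let L := h%:R * (k%:R - m%:R) / m%:R - q * h%:R ^+ 2 / (2 * m%:R) in
  let kap := 18 * h%:R ^+ 3 / m%:R ^+ 2 + 17 * A ^+ 2 * h%:R / m%:R in
  (0 < m < N)%N -> 1 <= A -> 0 < s -> s ^+ 2 = m%:R * q ->
  (8 * h%:R : R) <= m%:R -> 8 * A * s <= m%:R -> `|k%:R - m%:R| <= A * s ->
  expR (L - kap * (1 + h%:R * s / m%:R)) <= mean_ratio R N m h k
    <= expR (L + kap * (1 + h%:R * s / m%:R)).
Proof.
move=> q L kap mN A1 s0 sE hm Asm; set d := k%:R - m%:R => dA.
have M0 : 0 < m%:R :> R by rewrite ltr0n; case/andP: mN.
have N0 : 0 < N%:R :> R by rewrite ltr0n; case/andP: mN; lia.
have q01 : 0 <= q <= 1.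
  rewrite /q subr_ge0 ler_pdivrMr// mul1r ler_nat lerBlDr lerDl divr_ge0//.
  by rewrite ltnW//; case/andP: mN.
have /andP[q0 q1] := q01.
have sm : s ^+ 2 <= m%:R by rewrite sE ler_piMr// ltW.
have As0 : 0 <= A * s by rewrite mulr_ge0 ?(ltW s0)// (le_trans ler01).
pose u i : R := (d - q * i%:R) / (m%:R - m%:R / N%:R * i%:R).
have den i : (i < h)%N -> (m%:R / 2 : R) <= m%:R - m%:R / N%:R * i%:R.
  move=> ih; have ih' : (i%:R : R) <= h%:R by rewrite ler_nat ltnW.
  have mi : m%:R / N%:R * i%:R <= (1 : R) * i%:R.
    by rewrite ler_wpM2r// -subr_ge0.
  clear -mi ih' hm M0; lra.
have den0 i : (i < h)%N -> (0 : R) < m%:R - m%:R / N%:R * i%:R.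
  by move=> ih; apply: lt_le_trans (den i ih); rewrite divr_gt0.
have rE : mean_ratio R N m h k = \prod_(i < h) (1 + u i).
  apply: eq_bigr => i _; have := den0 i (ltn_ord i).
  move=> /lt0r_neq0 di; rewrite /u /d /q.
  apply: (mulIf di); rewrite divfK// mulrDl divfK// /d.
  by move: (m%:R / N%:R) => ?; ring.
have num i : (i < h)%N -> `|d - q * i%:R| <= A * s + h%:R.
  move=> ih; apply: le_trans (ler_normB _ _) _; apply: lerD => //.
  rewrite normrM (ger0_norm q0) ger0_norm//.
  apply: (@le_trans _ _ (1 * i%:R)); first by rewrite ler_wpM2r.
  by rewrite mul1r ler_nat ltnW.
have ub i : (i < h)%N -> `|u i| <= 2 * (A * s + h%:R) / m%:R.
  move=> ih; rewrite normrM normfV (gtr0_norm (den0 i ih)).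
  rewrite ler_pdivrMr ?den0//; apply: (le_trans (num i ih)).
  rewrite [leLHS](_ : _ = 2 * (A * s + h%:R) / m%:R * (m%:R / 2)); last first.
    by field; rewrite gt_eqF.
  rewrite ler_wpM2l ?den// divr_ge0 ?(ltW M0)// mulr_ge0// addr_ge0//.
have bnd12 : 2 * (A * s + h%:R) / m%:R <= 1 / 2.
  by rewrite ler_pdivrMr//; clear -hm Asm; lra.
have u12 i : (i < h)%N -> `|u i| <= 1 / 2.
  by move=> ih; exact: le_trans (ub i ih) bnd12.
have sumL : \sum_(i < h) ((d - q * i%:R) / m%:R) = L + q * h%:R / (2 * m%:R).
  rewrite -mulr_suml sum_affine /L -/d; move: (q) (d) => x y.
  by field; rewrite gt_eqF.
have lin i : (i < h)%N ->
    `|u i - (d - q * i%:R) / m%:R| <= 2 * (A * s + h%:R) * h%:R / m%:R ^+ 2.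
  move=> ih; have di := den0 i ih.
  have -> : u i - (d - q * i%:R) / m%:R = u i * (m%:R / N%:R * i%:R) / m%:R.
    rewrite /u; move: di; move: (m%:R / N%:R * i%:R) => y di.
    by field; rewrite !gt_eqF.
  rewrite normrM normfV (gtr0_norm M0) ler_pdivrMr//.
  rewrite normrM.
  apply: (@le_trans _ _ (2 * (A * s + h%:R) / m%:R * h%:R)).
    apply: ler_pM; rewrite ?normr_ge0 ?ub// ger0_norm; last first.
      by rewrite mulr_ge0// divr_ge0// ltW.
    apply: (@le_trans _ _ (1 * i%:R)).
      by rewrite ler_wpM2r// -subr_ge0.
    by rewrite mul1r ler_nat ltnW.
  by rewrite le_eqVlt; apply/orP; left; apply/eqP; field; rewrite gt_eqF.
have sumlin : `|\sum_(i < h) u i - (L + q * h%:R / (2 * m%:R))|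
    <= h%:R * (2 * (A * s + h%:R) * h%:R / m%:R ^+ 2).
  rewrite -sumL -sumrB; apply: le_trans (ler_norm_sum _ _ _) _.
  apply: (@le_trans _ _ (\sum_(i < h) (2 * (A * s + h%:R) * h%:R / m%:R ^+ 2))).
    by apply: ler_sum => i _; exact: lin.
  by rewrite sumr_const card_ord -[leLHS]mulr_natl.
have sumsq : \sum_(i < h) (2 * u i ^+ 2)
    <= h%:R * (2 * (2 * (A * s + h%:R) / m%:R) ^+ 2).
  apply: (@le_trans _ _ (\sum_(i < h) (2 * (2 * (A * s + h%:R) / m%:R) ^+ 2))).
    apply: ler_sum => i _; rewrite ler_wpM2l// -real_normK ?num_real//.
    rewrite ler_pXn2r ?nnegrE ?ub//.
    by rewrite (le_trans _ (ub i (ltn_ord i))).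
  by rewrite sumr_const card_ord -[leLHS]mulr_natl.
have total : h%:R * (2 * (A * s + h%:R) * h%:R / m%:R ^+ 2)
    + h%:R * (2 * (2 * (A * s + h%:R) / m%:R) ^+ 2) + h%:R / (2 * m%:R)
    <= kap * (1 + h%:R * s / m%:R).
  exact: error_terms_le.
have qh : 0 <= q * h%:R / (2 * m%:R) <= h%:R / (2 * m%:R).
  apply/andP; split; first by rewrite divr_ge0 ?mulr_ge0// ltW.
  by rewrite ler_wpM2r ?invr_ge0 ?mulr_ge0 ?(ltW M0)// ler_piMl.
have := prod1D_exp u12; rewrite rE => /andP[lo hi].
have sq0 : 0 <= \sum_(i < h) (2 * u i ^+ 2).
  by apply: sumr_ge0 => i _; rewrite mulr_ge0// sqr_ge0.
move: sumlin; rewrite ler_norml => /andP[sl1 sl2].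
have {qh} /andP[qh0 qh1] := qh.
have sm0 := le_trans sq0 sumsq.
apply/andP; split.
  apply: le_trans lo; rewrite ler_expR sumrB.
  by clear -sumsq total sl1 qh0 qh1; lra.
apply: (le_trans hi); rewrite ler_expR.
by clear -sm0 total sl2 qh1; lra.
Qed.

(** * The asymptotic regime *)

Lemma bin2_bounds (R : realType) n : (0 < 'C(n, 2))%N ->
  n%:R ^+ 2 <= 4 * 'C(n, 2)%:R :> R /\ 2 * 'C(n, 2)%:R <= n%:R ^+ 2 :> R.
Proof.
rewrite bin_gt0 => n2; have E := mul_bin_left n 1; rewrite bin1 in E.
have {}E : (2 * 'C(n, 2) = (n - 1) * n)%N by rewrite -E.
by rewrite -natrX -!natrM !ler_nat; split; nia.
Qed.

(** The parameter t stands for h^(1/3).  With D of order t, the three terms of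
    the bound have orders t^3, t^4 and t^2 n, and the last one dominates. *)
Lemma blocked_bound_scale (R : realType) (n h D : nat) (c C t : R) :
  (0 < n)%N -> 0 < c -> 0 < C -> 1 <= t -> t ^+ 3 = h%:R -> t ^+ 2 <= n%:R ->
  c * t <= D%:R <= C * t ->
  blocked_bound R n h D <= (2 + 2 * C + 2 / c) * (t ^+ 2 * n%:R).
Proof.
move=> n0 c0 C0 t1 th tn /andP[cD DC]; rewrite /blocked_bound.
have t0 : 0 < t by exact: lt_le_trans ltr01 t1.
have n1 : (1 : R) <= n%:R by rewrite ler1n.
have n0' : (0 : R) < n%:R by rewrite ltr0n.
have t2 : 0 < t ^+ 2 by rewrite exprn_gt0.
have tt : t <= t ^+ 2 by rewrite expr2 ler_peMl// ltW.
have a1 : t ^+ 3 <= t ^+ 2 * n%:R.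
  by rewrite exprSr ler_wpM2l ?(ltW t2)// (le_trans tt).
have a2 : t ^+ 3 * D%:R <= C * (t ^+ 2 * n%:R).
  apply: (@le_trans _ _ (t ^+ 3 * (C * t))); first by rewrite ler_wpM2l ?exprn_ge0 ?(ltW t0).
  have -> : t ^+ 3 * (C * t) = C * (t ^+ 2 * t ^+ 2) by ring.
  by rewrite ler_wpM2l ?(ltW C0)// ler_wpM2l ?(ltW t2).
have D0 : (0 : R) < D%:R by apply: lt_le_trans cD; rewrite mulr_gt0.
have a3 : t ^+ 3 * n%:R / D%:R <= c^-1 * (t ^+ 2 * n%:R).
  rewrite ler_pdivrMr//.
  have -> : t ^+ 3 * n%:R = c^-1 * (t ^+ 2 * n%:R) * (c * t).
    by field; rewrite gt_eqF.
  by rewrite ler_wpM2l// mulr_ge0 ?invr_ge0 ?(ltW c0)// mulr_ge0// ltW.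
by rewrite -th; clear -a1 a2 a3; lra.
Qed.

(** For t = h^(1/3) the hypothesis t^8 <= e^4 p n^3 gives t^2 <= e n, hence
    the first bound; and the left-hand side of the second is of order
    t^2 h^2 / (n m), that is t^8 / (p n^3). *)
Lemma blocked_bound_small (R : realType) (n h D m : nat) (p c C t e : R) :
  let N : R := 'C(n, 2)%:R in let C2 := 2 + 2 * C + 2 / c in
  (0 < m)%N -> m%:R = p * N -> 0 < p < 1 -> 0 < c -> 0 < C ->
  1 <= t -> t ^+ 3 = h%:R -> c * t <= D%:R <= C * t ->
  0 < e <= 1 -> t ^+ 8 <= e ^+ 4 * (p * n%:R ^+ 3) ->
  blocked_bound R n h D <= 4 * C2 * e * N /\
  blocked_bound R n h D / N * h%:R ^+ 2 / m%:R <= 16 * C2 * e.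
Proof.
move=> N C2 m0 mp /andP[p0 p1] c0 C0 t1 th cD /andP[e0 e1] t8.
have M0 : (0 : R) < m%:R by rewrite ltr0n.
have N0 : 0 < N by move: M0; rewrite mp pmulr_rgt0.
have [nN Nn] : n%:R ^+ 2 <= 4 * N /\ 2 * N <= n%:R ^+ 2.
  by apply: bin2_bounds; rewrite -(ltr0n R).
have n0 : (0 < n)%N by move: N0; rewrite /N ltr0n bin_gt0; exact: ltnW.
have n1 : (1 : R) <= n%:R by rewrite ler1n.
have n0' : (0 : R) < n%:R by rewrite ltr0n.
have t0 : 0 < t by exact: lt_le_trans ltr01 t1.
have tn : t ^+ 2 <= e * n%:R.
  rewrite -(@ler_pXn2r _ 4)// ?nnegrE ?exprn_ge0 ?(ltW t0) ?mulr_ge0 ?(ltW e0)//.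
  rewrite -exprM; apply: (le_trans t8); rewrite exprMn ler_wpM2l ?exprn_ge0 ?(ltW e0)//.
  rewrite [leRHS]exprS; apply: ler_pM; rewrite ?exprn_ge0 ?(ltW p0)//.
  exact: le_trans (ltW p1) n1.
have tn' : t ^+ 2 <= n%:R by apply: (le_trans tn); rewrite ler_piMl.
have C20 : 0 < C2.
  by rewrite /C2 !addr_gt0// ?mulr_gt0 ?invr_gt0.
have bb := blocked_bound_scale n0 c0 C0 t1 th tn' cD.
rewrite -/C2 in bb.
split.
  apply: (le_trans bb).
  have -> : 4 * C2 * e * N = C2 * (e * (4 * N)) by ring.
  rewrite ler_wpM2l ?(ltW C20)//; apply: (@le_trans _ _ (e * n%:R * n%:R)).
    by rewrite ler_wpM2r.
  by rewrite -mulrA -expr2 ler_wpM2l ?(ltW e0).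
rewrite ler_pdivrMr// mulrAC ler_pdivrMr//.
apply: (@le_trans _ _ (C2 * (t ^+ 2 * n%:R) * h%:R ^+ 2)).
  by rewrite ler_wpM2r// sqr_ge0.
rewrite -th.
have -> : C2 * (t ^+ 2 * n%:R) * (t ^+ 3) ^+ 2 = C2 * (t ^+ 8 * n%:R) by ring.
have -> : 16 * C2 * e * m%:R * N = C2 * (16 * e * m%:R * N) by ring.
rewrite ler_wpM2l ?(ltW C20)//.
apply: (@le_trans _ _ (e ^+ 4 * (p * n%:R ^+ 3) * n%:R)); first by rewrite ler_wpM2r.
have -> : e ^+ 4 * (p * n%:R ^+ 3) * n%:R = e ^+ 4 * (p * (n%:R ^+ 2 * n%:R ^+ 2)).
  by ring.
have -> : 16 * e * m%:R * N = e * (p * (4 * N * (4 * N))) by rewrite mp; ring.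
apply: ler_pM; rewrite ?exprn_ge0 ?(ltW e0)//.
- by rewrite mulr_ge0 ?(ltW p0)// mulr_ge0 ?sqr_ge0.
- by rewrite exprS ler_piMr ?(ltW e0)// exprn_ile1 ?(ltW e0).
by rewrite ler_wpM2l ?(ltW p0)//; apply: ler_pM; rewrite ?sqr_ge0.
Qed.

(** What the probabilistic arguments use about one fixed n; under the
    hypotheses of the theorem it holds for every e > 0 and all large n. *)
Definition sparse_regime (R : realType) (p : R) (n m h D : nat) (e : R) : Prop :=
  [/\ (0 < m < 'C(n, 2))%N, m%:R = p * 'C(n, 2)%:R, (0 < D)%N /\ (0 < h)%N,
      blocked_bound R n h D <= 'C(n, 2)%:R / 2 /\
      blocked_bound R n h D / 'C(n, 2)%:R * h%:R ^+ 2 / m%:R <= e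
    & h%:R ^+ 3 / m%:R ^+ 2 <= e /\ h%:R / m%:R <= e].

(** The condition h^2 = Omega(m) turns h^3 = o(m^2) into h = o(m), since
    h / m = (h^3 / m^2) (m / h^2). *)
Lemma asymptotic_regime (R : realType) (p : nat -> R) (m h Delta : nat -> nat)
  (hp : \forall n \near \oo, 0 < p n < 1)
  (hm : \forall n \near \oo, (0 < m n < 'C(n, 2))%N)
  (hmp : \forall n \near \oo, (m n)%:R = p n * 'C(n, 2)%:R)
  (hOmega : (fun n => (h n)%:R ^+ 2 : R) =Omega_\oo (fun n => (m n)%:R : R))
  (ho1 : (fun n => (h n)%:R ^+ 3 : R) =o_\oo (fun n => (m n)%:R ^+ 2 : R))
  (ho2 : (fun n => (h n)%:R `^ (8 / 3) : R) =o_\oo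
         (fun n => p n * n%:R ^+ 3 : R))
  (hDelta : (fun n => (Delta n)%:R : R) =Theta_\oo
            (fun n => (h n)%:R `^ (1 / 3) : R)) (e : R) : 0 < e ->
  \forall n \near \oo,
    sparse_regime (p n) n (m n) (h n) (Delta n) e.
Proof.
move=> e0.
move: hOmega; rewrite eqOmegaE qualifE => /asboolP[a a0 Ha].
move: hDelta; rewrite eqThetaE qualifE => /asboolP[[c C] /= /andP[c0 C0] HD].
move/eqoP: ho1 => Ho1; move/eqoP: ho2 => Ho2.
pose C2 := 2 + 2 * C + 2 / c.
have C20 : 0 < C2 by rewrite /C2 !addr_gt0// ?mulr_gt0 ?invr_gt0.
(* These values make the two bounds of blocked_bound_small at most 1 / 2
   and e. *)
pose e' := Num.min 1 (Num.min (e / (16 * C2)) (1 / (8 * C2))).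
have e'0 : 0 < e'.
  by rewrite /e' !lt_min ltr01/= !divr_gt0// mulr_gt0.
have [e'1 [e'2 e'3]] : e' <= 1 /\ 16 * C2 * e' <= e /\ 4 * C2 * e' <= 1 / 2.
  have h1 : e' <= e / (16 * C2) by rewrite /e' !ge_min lexx !orbT.
  have h2 : e' <= 1 / (8 * C2) by rewrite /e' !ge_min lexx !orbT.
  split; first by rewrite /e' ge_min lexx.
  move: h1 h2; rewrite !ler_pdivlMr ?mulr_gt0// => h1 h2.
  by split; [rewrite mulrC|clear -h2; lra].
(* The second value makes h^3 <= a e m^2, whence h <= e m as a m <= h^2. *)
pose d := Num.min e (a * e).
have d0 : 0 < d by rewrite lt_min e0 mulr_gt0.
have {}Ho1 := Ho1 d d0.
have e4 : 0 < e' ^+ 4 by rewrite exprn_gt0.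
have {}Ho2 := Ho2 _ e4.
near=> n.
have pn : 0 < p n < 1 by near: n.
have mn : (0 < m n < 'C(n, 2))%N by near: n.
have mpn : (m n)%:R = p n * 'C(n, 2)%:R by near: n.
have /andP[p0 p1] := pn; have /andP[m0 mN] := mn.
have M0 : (0 : R) < (m n)%:R by rewrite ltr0n.
have Han : a * (m n)%:R <= (h n)%:R ^+ 2.
  suff : a * `|(m n)%:R : R| <= `|(h n)%:R ^+ 2 : R|.
    by rewrite !ger0_norm// exprn_ge0.
  by near: n.
have h0 : (0 < h n)%N.
  rewrite lt0n; apply/eqP => h0; move: Han; rewrite h0 expr0n/=.
  by rewrite leNgt mulr_gt0.
have H0 : (0 : R) < (h n)%:R by rewrite ltr0n.
have HDn : c * `|(h n)%:R `^ (1 / 3)| <= `|(Delta n)%:R : R| /\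
    `|(Delta n)%:R : R| <= C * `|(h n)%:R `^ (1 / 3)| by near: n.
pose t : R := (h n)%:R `^ (1 / 3).
have t1 : 1 <= t.
  have one : (1 : R) `^ (1 / 3) = 1 by rewrite powR1.
  rewrite -[leLHS]one /t.
  rewrite ge0_ler_powR// ?nnegrE// ?ler1n//; lra.
have tX k : t ^+ k = (h n)%:R `^ (k%:R / 3).
  by rewrite -powR_mulrn ?powR_ge0// -powRrM; congr (_ `^ _); ring.
have th : t ^+ 3 = (h n)%:R by rewrite tX divff// powRr1// ltW.
have [cD DC] : c * t <= (Delta n)%:R /\ (Delta n)%:R <= C * t.
  by move: HDn; rewrite -/t !ger0_norm// powR_ge0.
have t8 : t ^+ 8 <= e' ^+ 4 * (p n * n%:R ^+ 3).
  suff : `|(h n)%:R `^ (8 / 3) : R| <= e' ^+ 4 * `|p n * n%:R ^+ 3|.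
    rewrite tX !ger0_norm ?powR_ge0// mulr_ge0 ?(ltW p0)// exprn_ge0//.
  by near: n.
have h3 : (h n)%:R ^+ 3 <= d * (m n)%:R ^+ 2.
  suff : `|(h n)%:R ^+ 3 : R| <= d * `|(m n)%:R ^+ 2 : R|.
    by rewrite !ger0_norm// exprn_ge0.
  by near: n.
have e'01 : 0 < e' <= 1 by rewrite e'0.
have cDC : c * t <= (Delta n)%:R <= C * t by rewrite cD.
have [b1 b2] := blocked_bound_small m0 mpn pn c0 C0 t1 th cDC e'01 t8.
have N0 : (0 : R) < 'C(n, 2)%:R by rewrite ltr0n (leq_ltn_trans _ mN).
split=> //; split=> //.
- rewrite -(ltr0n R); apply: lt_le_trans cD; rewrite mulr_gt0//.
  exact: lt_le_trans ltr01 t1.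
- apply: (le_trans b1); rewrite mulrC ler_wpM2l ?(ltW N0)//.
  by rewrite -[leRHS]div1r.
- exact: le_trans b2 e'2.
- rewrite ler_pdivrMr ?exprn_gt0//; apply: (le_trans h3).
  by rewrite ler_wpM2r ?sqr_ge0// /d ge_min lexx.
rewrite ler_pdivrMr//.
have : (h n)%:R * (a * (m n)%:R) <= a * e * (m n)%:R ^+ 2.
  apply: (@le_trans _ _ ((h n)%:R * (h n)%:R ^+ 2)).
    by rewrite ler_wpM2l// ltW.
  rewrite -exprS; apply: (le_trans h3).
  by rewrite ler_wpM2r ?sqr_ge0// /d ge_min lexx orbT.
have -> : (h n)%:R * (a * (m n)%:R) = a * (m n)%:R * (h n)%:R by ring.
have -> : a * e * (m n)%:R ^+ 2 = a * (m n)%:R * (e * (m n)%:R) by ring.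
by rewrite ler_pM2l// mulr_gt0.
Unshelve. all: by end_near. Qed.

(** * The limit theorem *)

(** Some infimum over a tail is positive. *)
Lemma limn_einf_gt0 (R : realType) (u : nat -> R) :
  (0 < limn_einf (fun n => (u n)%:E))%E ->
  exists2 c, 0 < c & \forall n \near \oo, c <= u n.
Proof.
rewrite limn_einf_lim => u0.
have [n n0] : exists n, (0 < einfs (fun n => (u n)%:E) n)%E.
  apply: contrapT => /forallNP un.
  move: u0; apply/negP; rewrite -leNgt.
  apply: lime_le; first exact: is_cvg_einfs.
  by apply: nearW => n; rewrite leNgt; apply/negP/un.
have lb k : (n <= k)%N -> (einfs (fun n => (u n)%:E) n <= (u k)%:E)%E.
  by move=> nk; apply: ereal_inf_lbound; exists k.
move: n0 lb; case: (einfs _ n) => [c||] // c0 lb; last by have := lb n (leqnn n).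
exists c; first by rewrite -lte_fin.
by exists n => // k /= nk; rewrite -lee_fin lb.
Qed.

(** In the binomial model the number k of edges varies around m, so the bound is
    needed for all k >= m / 2 at once; it comes from (1 + y)^h <= exp(h y). *)
Lemma tf_count_deviation (R : realType) n h D m k (e ep : R) :
  let N : R := 'C(n, 2)%:R in
  (0 < D)%N -> blocked_bound R n h D <= N / 2 ->
  blocked_bound R n h D / N * h%:R ^+ 2 / m%:R <= ep -> ep <= 1 / 8 ->
  (0 < m)%N -> (m <= 2 * k)%N -> (h <= k <= 'C(n, 2))%N -> 0 < e ->
  gnm R k [pred G : graph n |
      e < `|(tf_count h D G)%:R / mu_ R k h D n - 1|] <= 8 * ep / e ^+ 2.
Proof.
move=> N D0 bN bm ep8 m0 mk hk e0.
have M0 : (0 : R) < m%:R by rewrite ltr0n.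
have k0 : (0 < k)%N by lia.
have K0 : (0 : R) < k%:R by rewrite ltr0n.
have D0' : (0 : R) < D%:R by rewrite ltr0n.
have b2h : 2 * h%:R <= blocked_bound R n h D.
  rewrite /blocked_bound -addrA lerDl addr_ge0// ?divr_ge0// !mulr_ge0//.
have b0 : 0 <= blocked_bound R n h D by apply: le_trans b2h; rewrite mulr_ge0.
have N0 : 0 < N by rewrite ltr0n; case/andP: hk => _; exact: leq_trans.
have hN : (2 * h <= 'C(n, 2))%N.
  by rewrite -(ler_nat R) natrM; apply: (le_trans b2h); apply: (le_trans bN); clear -N0; lra.
apply: (le_trans (tf_count_concentration D0 bN hN hk k0 e0)).
rewrite ler_wpM2r ?invr_ge0 ?sqr_ge0// -/N.
set y := 2 * _ / N * _ / _.
have y0 : 0 <= y.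
  by rewrite /y divr_ge0 ?(ltW K0)// mulr_ge0// divr_ge0 ?(ltW N0)// mulr_ge0.
have hy : h%:R * y <= 4 * ep.
  rewrite /y; have -> : h%:R * (2 * blocked_bound R n h D / N * h%:R / k%:R)
     = 2 * (blocked_bound R n h D / N * h%:R ^+ 2) / k%:R by ring.
  rewrite ler_pdivrMr//; move: bm; rewrite ler_pdivrMr// => bm.
  have mk' : (m%:R : R) <= 2 * k%:R by rewrite -natrM ler_nat.
  have ep0 : 0 <= ep.
    rewrite -(pmulr_lge0 _ M0); apply: le_trans bm.
    by rewrite mulr_ge0 ?sqr_ge0// divr_ge0// ltW.
  have := ler_wpM2l ep0 mk'; clear -bm; lra.
have hy0 : 0 <= h%:R * y by rewrite mulr_ge0.
have : (1 + y) ^+ h <= expR (h%:R * y).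
  rewrite mulrC expRM_natr lerXn2r ?nnegrE ?expR_ge0 ?expR_ge1Dx//.
  by rewrite addr_ge0.
have hy2 : h%:R * y <= 1 / 2 by clear -hy ep8; lra.
have := expR_le1D2 hy0 hy2.
by clear -hy; lra.
Qed.

Lemma betaE (R : realType) (p : R) n h m (s : R) :
  (0 < m)%N -> m%:R = p * 'C(n, 2)%:R -> 0 < s -> s ^+ 2 = m%:R * (1 - p) ->
  beta_ p h n = h%:R * s / m%:R.
Proof.
move=> m0 mp s0 sE; have M0 : (0 : R) < m%:R by rewrite ltr0n.
rewrite /beta_ -mp -mulrA; congr (_ * _).
have -> : (1 - p) / m%:R = (s / m%:R) ^+ 2.
  by rewrite expr_div_n sE; field; rewrite gt_eqF.
by rewrite sqrtr_sqr ger0_norm// divr_ge0// ltW.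
Qed.

Lemma normalized_count (R : realType) (p : R) n h D m k X :
  let r := X%:R / mu_ R k h D n in
  (0 < #|tf_family n h D|)%N ->
  (0 < m < 'C(n, 2))%N -> m%:R = p * 'C(n, 2)%:R -> (h <= k <= 'C(n, 2))%N ->
  X%:R / lambda_ p h D n = r * mean_ratio R 'C(n, 2) m h k.
Proof.
move=> r S0 mN mp hk; have /andP[p0 _] := binomial_param01 mN mp.
have S0' : (0 : R) < #|tf_family n h D|%:R by rewrite ltr0n.
rewrite -(mean_ratioE mN mp hk) /r /mu_ /lambda_.
have c1 : 'C('C(n, 2) - h, k - h)%:R != 0 :> R.
  by rewrite pnatr_eq0 -lt0n bin_gt0; case/andP: hk => ? ?; exact: leq_sub2r.
have c2 : 'C('C(n, 2), k)%:R != 0 :> R.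
  by rewrite pnatr_eq0 -lt0n bin_gt0; case/andP: hk.
have ph : p ^+ h != 0 by rewrite expf_neq0// gt_eqF.
by field; rewrite c1 c2 ph gt_eqF.
Qed.

(** Here z = (k - m) / s is the standardized number of edges k: the logarithm of
    the normalized count differs from z beta by at most eta beta, provided that the
    count X is within a factor 1 + e or 1 - e of its mean. *)
Lemma ln_normalized_count (R : realType) (p : R) n h D m k X (s A e c eta : R) :
  let kap := 18 * h%:R ^+ 3 / m%:R ^+ 2 + 17 * A ^+ 2 * h%:R / m%:R in
  let V := expR (beta_ p h n ^+ 2 / 2) * X%:R / lambda_ p h D n in
  (0 < #|tf_family n h D|)%N ->
  (0 < m < 'C(n, 2))%N -> m%:R = p * 'C(n, 2)%:R -> (k <= 'C(n, 2))%N ->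
  0 < s -> s ^+ 2 = m%:R * (1 - p) -> 1 <= A -> 8 * h%:R <= (m%:R : R) ->
  8 * A * s <= m%:R -> `|k%:R - m%:R| <= A * s ->
  0 < e <= 1 / 2 -> `|X%:R / mu_ R k h D n - 1| <= e ->
  0 < c <= beta_ p h n -> kap + 2 * e <= c * (eta - kap) ->
  0 < V /\ `|ln V - (k%:R - m%:R) / s * beta_ p h n| <= eta * beta_ p h n.
Proof.
move=> kap V S0 mN mp kN s0 sE A1 hm Asm kA /andP[e0 e1] rE /andP[c0 cb] eta_kap.
have m0 : (0 < m)%N by case/andP: mN.
have M0 : (0 : R) < m%:R by rewrite ltr0n.
have pE : p = m%:R / 'C(n, 2)%:R.
  by rewrite mp mulfK// pnatr_eq0 -lt0n; case/andP: mN => _; exact: leq_ltn_trans.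
have hk : (h <= k)%N.
  rewrite -(ler_nat R); move: kA; rewrite ler_norml => /andP[k1 _].
  have : 0 <= A * s by rewrite mulr_ge0 ?(ltW s0)// (le_trans ler01).
  have : (0 : R) <= h%:R by [].
  by clear -k1 Asm hm; lra.
have hkN : (h <= k <= 'C(n, 2))%N by rewrite hk.
have bE := betaE h m0 mp s0 sE.
have sE' : s ^+ 2 = m%:R * (1 - m%:R / 'C(n, 2)%:R) by rewrite -pE.
have := mean_ratio_error mN A1 s0 sE' hm Asm kA.
have LE : h%:R * (k%:R - m%:R) / m%:R
    - (1 - m%:R / 'C(n, 2)%:R) * h%:R ^+ 2 / (2 * m%:R)
    = (k%:R - m%:R) / s * beta_ p h n - beta_ p h n ^+ 2 / 2.
  rewrite bE -pE (_ : 1 - p = s ^+ 2 / m%:R); last first.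
    by rewrite sE mulrC mulKf// gt_eqF.
  by field; rewrite !gt_eqF.
rewrite LE -/kap -bE.
set b := beta_ p h n in c0 cb LE bE V *; set z := (k%:R - m%:R) / s.
move=> /andP[T1 T2].
have VE : V = expR (b ^+ 2 / 2) * (X%:R / mu_ R k h D n * mean_ratio R 'C(n, 2) m h k).
  by rewrite /V -mulrA (@normalized_count R p n h D m k X).
set r := X%:R / _ in rE VE; set T := mean_ratio _ _ _ _ _ in T1 T2 VE.
have [r1 r2] : expR (- (2 * e)) <= r /\ r <= expR (2 * e).
  move: rE; rewrite ler_norml => /andP[re1 re2]; split.
    apply: (@le_trans _ _ (1 - e)); last by clear -re1; lra.
    apply: (@le_trans _ _ (expR (- e - 2 * (- e) ^+ 2))); last first.
      by apply: expR_sub_sqr_le; clear -e1; lra.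
    rewrite ler_expR sqrrN -subr_ge0.
    have : 0 <= e * (1 - 2 * e) by rewrite mulr_ge0 ?(ltW e0)//; clear -e1; lra.
    by clear; lra.
  apply: (@le_trans _ _ (expR e)).
    by apply: le_trans (expR_ge1Dx e); clear -re2; lra.
  by rewrite ler_expR; clear -e0; lra.
have kap0 : 0 <= kap.
  rewrite /kap addr_ge0// divr_ge0 ?(ltW M0) ?sqr_ge0// mulr_ge0// ?exprn_ge0//.
  by rewrite mulr_ge0// sqr_ge0.
have key : kap * (1 + b) + 2 * e <= eta * b.
  have ek : 0 <= eta - kap.
    have : 0 <= c * (eta - kap).
      by apply: le_trans eta_kap; rewrite addr_ge0// mulr_ge0// ltW.
    by rewrite pmulr_rge0.
  have := ler_wpM2r ek cb; clear -eta_kap; lra.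
have V1 : expR (z * b - eta * b) <= V.
  rewrite VE; apply: (@le_trans _ _
     (expR (b ^+ 2 / 2) * (expR (- (2 * e)) *
        expR (z * b - b ^+ 2 / 2 - kap * (1 + b))))).
    by rewrite -!expRD ler_expR; clear -key; lra.
  by rewrite ler_wpM2l ?expR_ge0//; apply: ler_pM; rewrite ?expR_ge0.
have V2 : V <= expR (z * b + eta * b).
  rewrite VE; apply: (@le_trans _ _
     (expR (b ^+ 2 / 2) * (expR (2 * e) *
        expR (z * b - b ^+ 2 / 2 + kap * (1 + b))))); last first.
    by rewrite -!expRD ler_expR; clear -key; lra.
  rewrite ler_wpM2l ?expR_ge0//; apply: ler_pM => //.
    by apply: le_trans r1; exact: expR_ge0.
  by apply: le_trans T1; exact: expR_ge0.
have V0 : 0 < V by apply: lt_le_trans V1; exact: expR_gt0.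
split => //; rewrite ler_norml.
move: V1 V2; rewrite -{1 2}(lnK V0) !ler_expR.
by move=> V1 V2; apply/andP; split; [clear -V1|clear -V2]; lra.
Qed.

Definition normalized_log (R : realType) (p : R) n h D (G : graph n) : \bar R :=
  (lne (expR (beta_ p h n ^+ 2 / 2) * (tf_count h D G)%:R / lambda_ p h D n)%:E
   * ((beta_ p h n)^-1)%:E)%E.

(** On the good event the normalized logarithm is within eta of the standardized
    number of edges; the exceptional probability is at most 1 / A^2 for the number
    of edges, by Chebyshev's inequality, plus 8 ep / e^2 for the count. *)
Lemma normalized_log_cdf_bounds (R : realType) (p : R) n h D m (s A e c eta ep x : R) :
  let N := 'C(n, 2) in
  let kap := 18 * h%:R ^+ 3 / m%:R ^+ 2 + 17 * A ^+ 2 * h%:R / m%:R in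
  let F y := \sum_(k < N.+1 | k%:R <= m%:R + y * s) binomial_pmf N p k in
  let d := 1 / A ^+ 2 + 8 * ep / e ^+ 2 in
  (0 < m < N)%N -> m%:R = p * N%:R ->
  (0 < D)%N -> blocked_bound R n h D <= N%:R / 2 ->
  blocked_bound R n h D / N%:R * h%:R ^+ 2 / m%:R <= ep -> ep <= 1 / 8 ->
  0 < s -> s ^+ 2 = m%:R * (1 - p) -> 1 <= A -> 8 * h%:R <= (m%:R : R) ->
  8 * A * s <= m%:R -> 0 < e <= 1 / 2 ->
  0 < c <= beta_ p h n -> kap + 2 * e <= c * (eta - kap) ->
  F (x - eta) - d
    <= gnp p [pred G : graph n | (normalized_log p h D G <= x%:E)%E]
    <= F (x + eta) + d.
Proof.
move=> N kap F d mN mp D0 bN bm ep8 s0 sE A1 hm Asm e01 cb eta_kap.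
have /andP[m0 ltmN] := mN.
have M0 : (0 : R) < m%:R by rewrite ltr0n.
have N0 : (0 : R) < N%:R by rewrite ltr0n (leq_trans m0)// ltnW.
have /andP[p0 p1] := binomial_param01 mN mp.
have p01 : 0 <= p <= 1 by rewrite !ltW.
have A0 : 0 < A by exact: lt_le_trans ltr01 A1.
have As0 : 0 < A * s by rewrite mulr_gt0.
have /andP[c0 c_le] := cb.
have b0 : 0 < beta_ p h n by exact: lt_le_trans c0 c_le.
have /andP[e0 e1] := e01.
have S0 : (0 < #|tf_family n h D|)%N.
  by apply: (@tf_family_gt0 R) => //; apply: (le_lt_trans bN); clear -N0; lra.
pose B := [pred G : graph n |
  e < `|(tf_count h D G)%:R / mu_ R #|G| h D n - 1|].
pose W := [pred k : nat | `|k%:R - m%:R| < A * s].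
have ep0 : 0 <= ep.
  apply: le_trans bm; rewrite divr_ge0 ?mulr_ge0 ?sqr_ge0 ?divr_ge0//.
  by rewrite /blocked_bound !addr_ge0 ?mulr_ge0.
have d1_ge0 : 0 <= 8 * ep / e ^+ 2 by rewrite divr_ge0 ?sqr_ge0 ?mulr_ge0.
have Wlow k : W k -> (m <= 2 * k)%N /\ (h <= k)%N.
  rewrite inE ltr_norml => /andP[k1 _].
  have h0 : (0 : R) <= h%:R by [].
  by rewrite -!(ler_nat R) natrM; split; clear -k1 Asm hm h0 M0; lra.
have WB k : (k <= N)%N -> W k -> gnm R k B <= 8 * ep / e ^+ 2.
  move=> kN Wk; have [mk hk] := Wlow k Wk.
  have hkN : (h <= k <= 'C(n, 2))%N by rewrite hk.
  apply: le_trans (tf_count_deviation D0 bN bm ep8 m0 mk hkN e0).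
  by apply: gnm_le_gnm => G Gk; rewrite /= Gk.
have tailW : \sum_(k < N.+1 | ~~ W k) binomial_pmf N p k <= 1 / A ^+ 2.
  have := binomial_tail N p01 As0.
  rewrite [N%:R * p]mulrC -mp -sE (_ : s ^+ 2 / (A * s) ^+ 2 = 1 / A ^+ 2); last first.
    by field; rewrite (gt_eqF s0) (gt_eqF A0).
  by apply: le_trans; rewrite le_eqVlt; apply/orP; left; apply/eqP;
    apply: eq_bigl => k; rewrite /= -leNgt.
have core (G : graph n) : W #|G| -> ~~ B G -> 
    ((normalized_log p h D G <= x%:E)%E -> #|G|%:R <= m%:R + (x + eta) * s) /\
    (#|G|%:R <= m%:R + (x - eta) * s -> (normalized_log p h D G <= x%:E)%E).
  move=> WG; rewrite /= -leNgt => BG.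
  have kA : `|#|G|%:R - m%:R| <= A * s by exact: ltW.
  have [V0] := ln_normalized_count S0 mN mp (card_graph_le G) s0 sE A1 hm Asm kA e01
    BG cb eta_kap.
  rewrite /normalized_log lne_EFin// -EFinM lee_fin ler_pdivrMr//.
  set V := ln _; set b := beta_ p h n in b0 *.
  have -> : (#|G|%:R <= m%:R + (x + eta) * s)
      = ((#|G|%:R - m%:R) / s * b <= (x + eta) * b).
    by rewrite ler_pM2r// ler_pdivrMr// lerBlDl.
  have -> : (#|G|%:R <= m%:R + (x - eta) * s)
      = ((#|G|%:R - m%:R) / s * b <= (x - eta) * b).
    by rewrite ler_pM2r// ler_pdivrMr// lerBlDl.
  rewrite ler_norml => /andP[v1 v2].
  by split=> H; [clear -v1 H|clear -v2 H]; lra.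
have upper := @gnp_le R n p (8 * ep / e ^+ 2)
  [pred G : graph n | (normalized_log p h D G <= x%:E)%E] B
  [pred k : nat | k%:R <= m%:R + (x + eta) * s] W p01 WB d1_ge0
  (fun G WG BG => (core G WG BG).1).
have coreC (G : graph n) : W #|G| -> ~~ B G ->
    predC [pred G : graph n | (normalized_log p h D G <= x%:E)%E] G ->
    predC [pred k : nat | k%:R <= m%:R + (x - eta) * s] #|G|.
  by move=> WG BG /=; apply: contra; exact: (core G WG BG).2.
have := @gnp_le R n p (8 * ep / e ^+ 2) _ B _ W p01 WB d1_ge0 coreC.
rewrite gnp_predC -/N.
have split1 : F (x - eta) + \sum_(k < N.+1 |
    predC [pred k : nat | k%:R <= m%:R + (x - eta) * s] k) binomial_pmf N p k = 1.
  rewrite -[RHS](sum_binomial_pmf N p).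
  by rewrite [RHS](bigID (fun k : 'I_N.+1 => k%:R <= m%:R + (x - eta) * s)).
move=> lower; apply/andP; split.
  by rewrite /d; clear -lower split1 tailW; lra.
by apply: (le_trans upper); rewrite /d addrA lerD2r lerD2l.
Qed.

(** The variance s^2 = m (1 - p) is large in the regime: beta = h s / m >= c gives
    s^2 >= c^2 m^2 / h^2 >= c^2 h / e >= c^2 / e. *)
Lemma normalized_log_clt (R : realType) (c d x : R) : 0 < c -> 0 < d ->
  exists2 ep, 0 < ep & forall (p : R) n h D m,
    sparse_regime p n m h D ep -> c <= beta_ p h n ->
    `|std_cdf x - gnp p [pred G : graph n | (normalized_log p h D G <= x%:E)%E]|
      <= d.
Proof.
(* Four errors of size eta: the central limit theorem, the Lipschitz bound for
   the shift by eta, the tail of the number of edges, and the deviation of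
   the count. *)
move=> c0 d0; pose eta := d / 5.
have eta0 : 0 < eta by rewrite divr_gt0.
pose A := Num.max 1 eta^-1.
have [A1 Aeta] : 1 <= A /\ eta^-1 <= A by rewrite /A !le_max !lexx orbT.
have A0 : 0 < A by exact: lt_le_trans ltr01 A1.
have A2 : 0 < A ^+ 2 by rewrite exprn_gt0.
pose e := Num.min (1 / 2) (c * eta / 8).
have e0 : 0 < e by rewrite lt_min !divr_gt0// mulr_gt0.
have e2 : 0 < e ^+ 2 by rewrite exprn_gt0.
have [e1 ec] : e <= 1 / 2 /\ e <= c * eta / 8.
  by rewrite /e !ge_min !lexx orbT.
have [s1 clt1] := @binomial_clt R (x + eta) eta eta0.
have [s2 clt2] := @binomial_clt R (x - eta) eta eta0.
pose s0 := Num.max 1 (Num.max s1 s2).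
have [s01 [s0s1 s0s2]] : 1 <= s0 /\ s1 <= s0 /\ s2 <= s0.
  by rewrite /s0 !le_max !lexx !orbT.
have s00 : 0 < s0 by exact: lt_le_trans ltr01 s01.
(* In order: the hypothesis of the deviation bound and its value at most eta;
   a small error in the ratio of the means; 8 A s <= m; and s >= s0. *)
pose ep := Num.min (Num.min (1 / 8) (eta * e ^+ 2 / 8))
  (Num.min (Num.min (eta / (70 * A ^+ 2)) (c * eta / (140 * A ^+ 2)))
           (Num.min (1 / (64 * A ^+ 2)) (c ^+ 2 / s0 ^+ 2))).
exists ep.
  by rewrite !lt_min !divr_gt0 ?mulr_gt0 ?exprn_gt0.
have [ep1 [ep2 [ep3 [ep4 [ep5 ep6]]]]] : ep <= 1 / 8 /\ ep <= eta * e ^+ 2 / 8 /\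
   ep <= eta / (70 * A ^+ 2) /\ ep <= c * eta / (140 * A ^+ 2) /\
   ep <= 1 / (64 * A ^+ 2) /\ ep <= c ^+ 2 / s0 ^+ 2.
  by rewrite /ep !ge_min !lexx !orbT.
move=> p n h D m [mN mp [D0 h0] [bN bm] [h3m hm]] cb.
have m0 : (0 < m)%N by case/andP: mN.
have M0 : (0 : R) < m%:R by rewrite ltr0n.
have H0 : (0 : R) < h%:R by rewrite ltr0n.
have H1 : (1 : R) <= h%:R by rewrite ler1n.
have /andP[p0 p1] := binomial_param01 mN mp.
have q0 : 0 < 1 - p by rewrite subr_gt0.
pose s := Num.sqrt (m%:R * (1 - p)).
have s_gt0 : 0 < s by rewrite sqrtr_gt0 mulr_gt0.
have sE : s ^+ 2 = m%:R * (1 - p) by rewrite sqr_sqrtr// mulr_ge0// ltW.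
have sE' : s ^+ 2 = 'C(n, 2)%:R * p * (1 - p).
  by rewrite sE mp [p * _]mulrC.
have bE := betaE h m0 mp s_gt0 sE.
have ep_gt0 : 0 < ep by apply: lt_le_trans hm; rewrite divr_gt0.
have s0s : s0 <= s.
  rewrite -(@ler_pXn2r _ 2)// ?nnegrE ?(ltW s00) ?(ltW s_gt0)//.
  have h1 : c * m%:R <= h%:R * s by rewrite -ler_pdivlMr// -bE.
  have h2 : c ^+ 2 * m%:R ^+ 2 <= h%:R ^+ 2 * s ^+ 2.
    rewrite -!exprMn ler_pXn2r ?nnegrE ?mulr_ge0//; exact: ltW.
  have h3 : h%:R ^+ 3 <= ep * m%:R ^+ 2.
    by rewrite -ler_pdivrMr ?exprn_gt0.
  have h4 : s0 ^+ 2 * ep <= c ^+ 2 by rewrite mulrC -ler_pdivlMr ?exprn_gt0.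
  have h5 : s0 ^+ 2 * h%:R ^+ 2 <= s0 ^+ 2 * h%:R ^+ 3.
    by rewrite ler_wpM2l ?sqr_ge0// [leRHS]exprSr ler_peMr ?sqr_ge0.
  have h6 : s0 ^+ 2 * h%:R ^+ 3 <= c ^+ 2 * m%:R ^+ 2.
    apply: (@le_trans _ _ (s0 ^+ 2 * (ep * m%:R ^+ 2))).
      by rewrite ler_wpM2l ?sqr_ge0.
    by rewrite mulrA ler_wpM2r ?sqr_ge0.
  rewrite -(@ler_pM2l _ (h%:R ^+ 2)) ?exprn_gt0// mulrC.
  exact: le_trans h5 (le_trans h6 h2).
have hm8 : 8 * h%:R <= (m%:R : R).
  by move: (le_trans hm ep1); rewrite ler_pdivrMr//; clear; lra.
have m64 : 64 * A ^+ 2 <= m%:R.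
  have : h%:R / m%:R <= 1 / (64 * A ^+ 2) by exact: le_trans hm ep5.
  rewrite ler_pdivrMr// mulrAC mul1r ler_pdivlMr ?mulr_gt0// => H.
  by apply: le_trans H; rewrite ler_peMl// ltW// mulr_gt0.
have Asm : 8 * A * s <= m%:R.
  rewrite -(@ler_pXn2r _ 2)// ?nnegrE ?mulr_ge0 ?(ltW A0) ?(ltW s_gt0)//.
  rewrite exprMn sE exprMn (_ : 8 ^+ 2 = 64); last by ring.
  rewrite expr2 ; apply: ler_pM => //.
  - by rewrite mulr_ge0 ?(ltW A2).
  - by rewrite mulr_ge0 ?(ltW q0) ?(ltW M0).
  - by rewrite ler_piMr ?(ltW M0)// lerBlDr lerDl ltW.
have Aep : 35 * A ^+ 2 * ep <= eta / 2 /\ 35 * A ^+ 2 * ep <= c * eta / 4.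
  move: ep3 ep4; rewrite !ler_pdivlMr ?mulr_gt0//.
  by clear; move=> ? ?; split; lra.
have [Aep1 Aep2] := Aep.
set kap := 18 * h%:R ^+ 3 / m%:R ^+ 2 + 17 * A ^+ 2 * h%:R / m%:R.
have kapE : kap <= 35 * A ^+ 2 * ep.
  have A21 : 1 <= A ^+ 2 by rewrite expr_ge1// ltW.
  have k1 : 18 * (h%:R ^+ 3 / m%:R ^+ 2) <= 18 * A ^+ 2 * ep.
    apply: ler_pM; rewrite ?divr_ge0 ?exprn_ge0//.
    by rewrite ler_peMr.
  have k2 : 17 * A ^+ 2 * (h%:R / m%:R) <= 17 * A ^+ 2 * ep.
    by rewrite ler_wpM2l// mulr_ge0// ltW.
  by rewrite /kap; clear -k1 k2; lra.
have kap_eta : kap + 2 * e <= c * (eta - kap).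
  have ce : c * (eta / 2) <= c * (eta - kap).
    by rewrite ler_wpM2l ?(ltW c0)//; clear -kapE Aep1; lra.
  by clear -ce kapE Aep2 ec; lra.
have e01 : 0 < e <= 1 / 2 by rewrite e0.
have cb' : 0 < c <= beta_ p h n by rewrite c0.
have /andP[lo hi] := normalized_log_cdf_bounds x mN mp D0 bN bm ep1 s_gt0 sE A1
  hm8 Asm e01 cb' kap_eta.
have := clt1 _ _ _ _ mN mp (le_trans s0s1 s0s) s_gt0 sE'.
have := clt2 _ _ _ _ mN mp (le_trans s0s2 s0s) s_gt0 sE'.
have invA : 1 / A ^+ 2 <= eta.
  rewrite ler_pdivrMr// -ler_pdivrMl// mulr1 (le_trans Aeta)//.
  by rewrite expr2 ler_peMr// ltW.
have dev : 8 * ep / e ^+ 2 <= eta.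
  by rewrite ler_pdivrMr//; move: ep2; clear; lra.
have lip1 := std_cdf_shift x (ltW eta0).
have lip2 := std_cdf_shift (x - eta) (ltW eta0); rewrite subrK in lip2.
have d5 : d = 5 * eta by rewrite /eta; field.
rewrite !ler_norml d5 => /andP[cl1 cl2] /andP[cl3 cl4].
by apply/andP; split; [clear -hi cl4 lip1 invA dev eta0|clear -lo cl1 lip2 invA dev eta0]; lra.
Qed.

Theorem theorem10 (R : realType) (p : nat -> R) (m h Delta : nat -> nat)
  (hp : \forall n \near \oo, 0 < p n < 1)
  (hm : \forall n \near \oo, (0 < m n < 'C(n, 2))%N)
  (hmp : \forall n \near \oo, (m n)%:R = p n * 'C(n, 2)%:R)
  (hOmega : (fun n => (h n)%:R ^+ 2 : R) =Omega_\oo (fun n => (m n)%:R : R))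
  (ho1 : (fun n => (h n)%:R ^+ 3 : R) =o_\oo (fun n => (m n)%:R ^+ 2 : R))
  (ho2 : (fun n => (h n)%:R `^ (8 / 3) : R) =o_\oo
         (fun n => p n * n%:R ^+ 3 : R))
  (hDelta : (fun n => (Delta n)%:R : R) =Theta_\oo
            (fun n => (h n)%:R `^ (1 / 3) : R)) :
  cvg_in_probability (fun n => @gnm R n (m n))
    (fun n G => (tf_count (h n) (Delta n) G)%:R
                / mu_ R (m n) (h n) (Delta n) n) 1
  /\
  ((0 < limn_einf (fun n => (beta_ (p n) (h n) n)%:E))%E ->
   cvg_in_distribution (fun n => @gnp R n (p n))
     (fun n G =>
        (lne (expR (beta_ (p n) (h n) n ^+ 2 / 2)
              * (tf_count (h n) (Delta n) G)%:R
              / lambda_ (p n) (h n) (Delta n) n)%:E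
         * ((beta_ (p n) (h n) n)^-1)%:E)%E)
     (normal_prob 0 1)).
Proof.
have regime := asymptotic_regime hp hm hmp hOmega ho1 ho2 hDelta.
split=> [e e0|/limn_einf_gt0[c c0 cb] F x _]; apply/cvgrPdist_le => d d0.
  pose ep := Num.min (1 / 8) (d * e ^+ 2 / 8).
  have e2 : 0 < e ^+ 2 by rewrite exprn_gt0.
  have ep0 : 0 < ep by rewrite lt_min !divr_gt0// mulr_gt0.
  have [ep1 ep2] : ep <= 1 / 8 /\ ep <= d * e ^+ 2 / 8.
    by rewrite /ep !ge_min !lexx orbT.
  near=> n; rewrite sub0r normrN ger0_norm ?gnm_ge0//.
  have [mn _ [D0 _] [bN bm] [_ hm1]] :
    sparse_regime (p n) n (m n) (h n) (Delta n) ep.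
    by near: n; exact: regime.
  have /andP[m0 mN] := mn.
  have M0 : (0 : R) < (m n)%:R by rewrite ltr0n.
  have hm' : (h n <= m n)%N.
    rewrite -(ler_nat R); move: (le_trans hm1 ep1); rewrite ler_pdivrMr//.
    by clear -M0; lra.
  have m2 : (m n <= 2 * m n)%N by rewrite mul2n -addnn leq_addr.
  have hmN : (h n <= m n <= 'C(n, 2))%N by rewrite hm' ltnW.
  apply: (le_trans (tf_count_deviation D0 bN bm ep1 m0 m2 hmN e0)).
  by rewrite ler_pdivrMr//; clear -ep2; lra.
have [ep ep0 close] := @normalized_log_clt R c d x c0 d0.
near=> n.
have reg :
    sparse_regime (p n) n (m n) (h n) (Delta n) ep.
  by near: n; exact: regime.
have cbn : c <= beta_ (p n) (h n) n by near: n.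
exact: close reg cbn.
Unshelve. all: by end_near. Qed.
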